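(* For every $\tau\in(0,\infty]$ there exists a positively expansive topological dynamical system $(X,f)$ satisfying the non-uniform $\tau$-specification property such that the intermediate entropy property holds for $(X,f)$, while the intermediate pressure property does not.
   Context: A topological dynamical system $(X,f)$ consists of a compact metric space $(X,d)$ with at least two points and a continuous map $f:X\to X$; $h_{top}(f)$ and $h_\mu(f)$ are topological and measure-theoretic entropy; $\mathcal{M}_f(X)$, $\mathcal{M}_f^{erg}(X)$ are the $f$-invariant, resp. $f$-ergodic, Borel probability measures; $C(X)$ is the space of real continuous functions on $X$. $f$ is positively expansive if there is $\varepsilon_0>0$ such that $x\ne y$ implies $d(f^ix,f^iy)\ge\varepsilon_0$ for some integer $i\ge0$. Intermediate entropy property: every $h$ with $0\le h<h_{top}(f)$ equals $h_\mu(f)$ for some $\mu\in\mathcal{M}_f^{erg}(X)$. Intermediate pressure property: for $\phi\in C(X)$ and $\mu\in\mathcal{M}_f(X)$ let $P_\mu(f,\phi)=h_\mu(f)+\int_X\phi\,d\mu$, $P(f,\phi)=\sup_{\mu\in\mathcal{M}_f(X)}P_\mu(f,\phi)$ (the topological pressure) and $P_{\inf}(f,\phi)=\inf_{\mu\in\mathcal{M}_f(X)}P_\mu(f,\phi)$. The property holds if for every $\phi\in C(X)$, every $P$ with $P_{\inf}(f,\phi)<P<P(f,\phi)$ equals $P_\mu(f,\phi)$ for some $\mu\in\mathcal{M}_f^{erg}(X)$. Non-uniform specification: $(X,f)$ has the non-uniform specification property with gap function $M:\mathbb{N}\times(0,\infty)\to\mathbb{N}$ ($\mathbb{N}$ the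 positive integers) if $M(n,\varepsilon)$ is non-decreasing in $n$ and non-increasing in $\varepsilon$, and for every $\varepsilon>0$, every integer $k\ge2$, all $x_1,\dots,x_k\in X$ and all non-negative integers $a_1\le b_1<a_2\le b_2<\cdots<a_k\le b_k$ with $a_{i+1}-b_i\ge M(b_i-a_i+1,\varepsilon)$ for $1\le i\le k-1$, there is $z\in X$ with $d(f^{n-a_i}x_i,f^nz)\le\varepsilon$ for all $a_i\le n\le b_i$, $1\le i\le k$. Let $\mathscr{G}(X,f)$ be the set of all such gap functions for $(X,f)$ and $\tau(M)=\sup_{\varepsilon>0}\liminf_{n\to\infty}M(n,\varepsilon)/n\in[0,\infty]$. $(X,f)$ has the non-uniform $\tau$-specification property if there is $M\in\mathscr{G}(X,f)$ with $\tau(M)=\tau$ and every $M'\in\mathscr{G}(X,f)$ satisfies $\tau(M')\ge\tau$. *)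

(* Defs.v *)
From HB Require Import structures.
From mathcomp Require Import all_boot all_order all_algebra finmap.
From mathcomp Require Import all_classical all_reals all_analysis.
Import Order.TTheory GRing.Theory Num.Theory.
Import numFieldNormedType.Exports.

Set Implicit Arguments.
Unset Strict Implicit.
Unset Printing Implicit Defensive.

Local Open Scope classical_set_scope.
Local Open Scope ring_scope.

(* The base point plays no mathematical role (all the spaces below have at
   least two points): [g_sigma_algebraType] requires a pointed carrier. *)
#[short(type="pointedMetricType")]
HB.structure Definition PointedMetric (K : numDomainType) :=
  {M of Pointed M & Metric K M}.

Definition tds (R : realType) (X : pointedMetricType R) (f : X -> X) : Prop :=
  [/\ compact [set: X], (exists x y : X, x <> y) & continuous f].

Definition positively_expansive (R : realType) (X : pointedMetricType R)
    (f : X -> X) : Prop :=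
  exists2 eps0 : R, 0 < eps0 &
    forall x y : X, x <> y ->
      exists i : nat, eps0 <= mdist (iter i f x) (iter i f y).

Definition borel (R : realType) (X : pointedMetricType R) :=
  g_sigma_algebraType (@open X).

Definition invariant_measure (R : realType) (X : pointedMetricType R) (f : X -> X)
    (mu : probability (borel X) R) : Prop :=
  forall A : set (borel X), measurable A -> mu (f @^-1` A) = mu A.

Definition ergodic_measure (R : realType) (X : pointedMetricType R) (f : X -> X)
    (mu : probability (borel X) R) : Prop :=
  invariant_measure f mu /\
  forall A : set (borel X), measurable A -> f @^-1` A = A ->
    mu A = 0%E \/ mu A = 1%E.

Definition measurable_partition (R : realType) (X : pointedMetricType R)
    (k : nat) (xi : 'I_k -> set (borel X)) : Prop :=
  (forall i, measurable (xi i)) /\ partition [set: 'I_k] xi [set: X].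

(* The cell with itinerary [w] of the join of the partitions f^{-i} xi,
   0 <= i < n; cells may be empty, which is harmless as 0 * ln 0 = 0. *)
Definition join_cell (R : realType) (X : pointedMetricType R) (f : X -> X)
    (k : nat) (xi : 'I_k -> set (borel X)) (n : nat) (w : {ffun 'I_n -> 'I_k}) :
    set (borel X) :=
  \bigcap_(i in [set: 'I_n]) iter i f @^-1` xi (w i).

Definition join_entropy (R : realType) (X : pointedMetricType R) (f : X -> X)
    (mu : probability (borel X) R) (k : nat) (xi : 'I_k -> set (borel X))
    (n : nat) : R :=
  - \sum_(w : {ffun 'I_n -> 'I_k})
      fine (mu (join_cell f xi w)) * ln (fine (mu (join_cell f xi w))).

Definition partition_entropy (R : realType) (X : pointedMetricType R)
    (f : X -> X) (mu : probability (borel X) R)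
    (k : nat) (xi : 'I_k -> set (borel X)) : \bar R :=
  limn (fun n => (join_entropy f mu xi n / n%:R)%:E).

(* Kolmogorov-Sinai entropy. *)
Definition measure_entropy (R : realType) (X : pointedMetricType R)
    (f : X -> X) (mu : probability (borel X) R) : \bar R :=
  ereal_sup [set h | exists (k : nat) (xi : 'I_k -> set (borel X)),
    measurable_partition xi /\ h = partition_entropy f mu xi].

Definition orbit_separated (R : realType) (X : pointedMetricType R) (f : X -> X)
    (n : nat) (eps : R) (E : {fset X}) : Prop :=
  forall x y, x \in E -> y \in E -> x <> y ->
    exists2 i : nat, (i < n)%N & eps < mdist (iter i f x) (iter i f y).

Definition max_separated (R : realType) (X : pointedMetricType R)
    (f : X -> X) (n : nat) (eps : R) : \bar R :=
  ereal_sup [set (#|` E|%:R)%:E | E in orbit_separated f n eps].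

Definition separated_growth (R : realType) (X : pointedMetricType R)
    (f : X -> X) (eps : R) : \bar R :=
  limn_esup (fun n => lne (max_separated f n eps) * (n%:R^-1)%:E)%E.

(* Bowen's definition by separated sets. *)
Definition topological_entropy (R : realType) (X : pointedMetricType R)
    (f : X -> X) : \bar R :=
  lim (separated_growth f eps @[eps --> (0 : R)^'+]).

Definition intermediate_entropy_property (R : realType)
    (X : pointedMetricType R) (f : X -> X) : Prop :=
  forall h : R, 0 <= h -> (h%:E < topological_entropy f)%E ->
    exists mu : probability (borel X) R,
      ergodic_measure f mu /\ measure_entropy f mu = h%:E.

Definition measure_pressure (R : realType) (X : pointedMetricType R)
    (f : X -> X) (phi : X -> R) (mu : probability (borel X) R) : \bar R :=
  (measure_entropy f mu + \int[mu]_(x in [set: borel X]) (phi x)%:E)%E.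

Definition pressure (R : realType) (X : pointedMetricType R) (f : X -> X)
    (phi : X -> R) : \bar R :=
  ereal_sup [set measure_pressure f phi mu | mu in invariant_measure f].

Definition inf_pressure (R : realType) (X : pointedMetricType R)
    (f : X -> X) (phi : X -> R) : \bar R :=
  ereal_inf [set measure_pressure f phi mu | mu in invariant_measure f].

Definition intermediate_pressure_property (R : realType)
    (X : pointedMetricType R) (f : X -> X) : Prop :=
  forall phi : X -> R, continuous phi ->
  forall P : R, (inf_pressure f phi < P%:E)%E -> (P%:E < pressure f phi)%E ->
    exists mu : probability (borel X) R,
      ergodic_measure f mu /\ measure_pressure f phi mu = P%:E.

(* The orbit segments (x_i, a_i, b_i) are indexed from 0 to k - 1. *)
Definition specification_at (R : realType) (X : pointedMetricType R)
    (f : X -> X) (M : nat -> R -> nat) (eps : R) : Prop :=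
  forall k : nat, (2 <= k)%N ->
  forall (x : nat -> X) (a b : nat -> nat),
    (forall i, (i < k)%N -> (a i <= b i)%N) ->
    (forall i, (i.+1 < k)%N -> (b i < a i.+1)%N) ->
    (forall i, (i.+1 < k)%N ->
       (M (b i - a i).+1 eps <= a i.+1 - b i)%N) ->
  exists z : X, forall i n : nat, (i < k)%N -> (a i <= n <= b i)%N ->
    mdist (iter (n - a i)%N f (x i)) (iter n f z) <= eps.

(* A gap function has domain {n > 0} * {eps > 0} and positive values; the
   values of [M] outside of this domain are irrelevant. *)
Definition gap_function (R : realType) (X : pointedMetricType R) (f : X -> X)
    (M : nat -> R -> nat) : Prop :=
  [/\ (forall n eps, (0 < n)%N -> 0 < eps -> (0 < M n eps)%N),
      (forall m n eps, (0 < m)%N -> (m <= n)%N -> 0 < eps ->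
         (M m eps <= M n eps)%N),
      (forall n eps delta, (0 < n)%N -> 0 < eps -> eps <= delta ->
         (M n delta <= M n eps)%N) &
      (forall eps, 0 < eps -> specification_at f M eps)].

Definition gap_rate (R : realType) (M : nat -> R -> nat) : \bar R :=
  ereal_sup [set limn_einf (fun n => ((M n eps)%:R / n%:R)%:E)
            | eps in [set eps : R | 0 < eps]].

Definition nonuniform_specification (R : realType) (X : pointedMetricType R)
    (f : X -> X) (tau : \bar R) : Prop :=
  (exists M, gap_function f M /\ gap_rate M = tau) /\
  (forall M, gap_function f M -> (tau <= gap_rate M)%E).

(* Main.v *)
Require Import Defs.
From HB Require Import structures.
From mathcomp Require Import all_boot all_order all_algebra finmap.
From mathcomp Require Import all_classical all_reals all_analysis.
From mathcomp Require Import measurable_realfun lebesgue_measure.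
From mathcomp Require Import zify ring lra.
Import Order.TTheory GRing.Theory Num.Theory.
Import numFieldNormedType.Exports.

(** The system is the one-sided subshift on the symbols 0, 1, 2 in which every
    run of l nonzero symbols that ends is followed by at least g(l) zeros, where
    g(n)/n tends to tau and the sum of the 2^-g(k) is at most 1/4. A word of
    length n can be followed by anything after g(n) zeros, and the word 1^n needs
    that many, so the optimal gap rate is tau.

    As the gaps are so long, words containing zeros do not contribute: there are
    at most 8 * 2^n words of length n, so the topological entropy is at most the
    entropy ln 2 of the full shift on {1, 2}, whose Bernoulli measures therefore
    realize all the intermediate entropies.

    If n <= q g(n) for all n, then an ergodic measure either lives on the full
    shift on {1, 2} or gives mass at most q/(q+1) to the cylinder x_0 <> 0. Since
    all entropies are at most ln 3, the pressures of the ergodic measures for a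
    large multiple of the indicator of that cylinder leave a gap. *)

(** The two properties pull in opposite directions. For pressure to fail, no ergodic measure may
    give the nonzero symbols a frequency close to 1 but below it: this is what the linear growth of
    [g], hence tau > 0, provides, since every finite run is paid for by a fixed proportion of zeros.
    For entropy, zeros must create no new entropy even when tau is tiny; a large additive constant
    in [g] ensures this without changing the rate.

    Only upper bounds of entropies are needed besides the Bernoulli case, so no variational
    principle enters. The costly point is the supremum over all finite partitions in the entropy of
    a measure. A partition is approximated by one that reads finitely many symbols, and the error is
    paid for by Gibbs' inequality, with a conditional law that trusts this approximation up to a
    small error probability. The Bernoulli measures are images of Lebesgue measure on [0, 1) under a
    coding by two affine branches, so that cylinders become intervals. *)

Set Implicit Arguments.
Unset Strict Implicit.
Unset Printing Implicit Defensive.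

Local Open Scope classical_set_scope.
Local Open Scope ring_scope.

(** * The gap subshift *)

(* All the runs of nonzero symbols are considered, and not only the maximal ones:
   this makes no difference when [g] is nondecreasing. *)
Definition admissible (g : nat -> nat) (x : nat -> 'I_3) : Prop :=
  forall i l j : nat, (0 < l)%N -> (forall t, (t < l)%N -> x (i + t)%N != ord0) ->
    x (i + l)%N = ord0 -> (j < g l)%N -> x (i + l + j)%N = ord0.

(* [R] is only there for the metric to be inferred from the type. *)
Record gap_shift (R : realType) (g : nat -> nat) :=
  GapShift { coord :> nat -> 'I_3; coordP : admissible g coord }.

Lemma gap_shift_ext (R : realType) (g : nat -> nat) (x y : gap_shift R g) :
  (forall n, x n = y n) -> x = y.
Proof.
case: x y => [x px] [y py] /= /funext xy; move: px py; rewrite xy => px py.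
by rewrite (Prop_irrelevance px py).
Qed.

Lemma gap_shift_diff (R : realType) (g : nat -> nat) (x y : gap_shift R g) :
  x <> y -> exists n, x n != y n.
Proof.
move=> xy; apply: contrapT => /forallNP h; apply: xy; apply: gap_shift_ext => n.
by apply/eqP/negPn/negP/h.
Qed.

Lemma admissible_cst (g : nat -> nat) (s : 'I_3) : admissible g (fun=> s).
Proof. by move=> i l j l0 /(_ _ l0) /eqP. Qed.

HB.instance Definition _ (R : realType) (g : nat -> nat) :=
  gen_eqMixin (gap_shift R g).
HB.instance Definition _ (R : realType) (g : nat -> nat) :=
  gen_choiceMixin (gap_shift R g).
HB.instance Definition _ (R : realType) (g : nat -> nat) :=
  isPointed.Build (gap_shift R g) (GapShift R (@admissible_cst g ord0)).

(** * The ultrametric given by the first disagreement *)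

Section metric.
Context (R : realType) (g : nat -> nat).
Implicit Types x y z : gap_shift R g.

(** With reciprocals as values, agreement on as many symbols as the truncation of 1/e guarantees a
    distance of at most e. *)
Definition gap_dist x y : R :=
  match pselect (exists n, x n != y n) with
  | left e => (ex_minn e).+1%:R^-1
  | right _ => 0
  end.

Lemma gap_dist_leP x y (n : nat) :
  gap_dist x y <= n.+1%:R^-1 <-> forall i, (i < n)%N -> x i = y i.
Proof.
rewrite /gap_dist; case: pselect => [e|e]; last first.
  split=> [_ i _|_]; last by rewrite invr_ge0.
  by apply/eqP/negPn/negP => xy; apply: e; exists i.
case: ex_minnP => m xym min; rewrite lef_pV2 ?posrE// ler_nat ltnS; split.
  move=> nm i iltn; apply/eqP/negPn/negP => /min; lia.
by move=> xy; rewrite leqNgt; apply/negP => /xy/eqP; apply/negP.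
Qed.

Lemma gap_distP x y : gap_dist x y = 0 \/ exists n : nat, gap_dist x y = n.+1%:R^-1.
Proof. by rewrite /gap_dist; case: pselect => [e|e]; [right; eexists|left]. Qed.

Lemma gap_dist_ge0 x y : 0 <= gap_dist x y.
Proof. by case: (gap_distP x y) => [->//|[n ->]]; rewrite invr_ge0. Qed.

Lemma gap_distxx x : gap_dist x x = 0.
Proof.
by rewrite /gap_dist; case: pselect => // e; exfalso; case: e => n; rewrite eqxx.
Qed.

Lemma gap_dist_positivity x y : gap_dist x y = 0 -> x = y.
Proof.
move=> d0; apply: gap_shift_ext => n.
by apply: (iffLR (gap_dist_leP x y n.+1)) => //; rewrite d0 invr_ge0.
Qed.

Lemma gap_dist_le_sym x y : gap_dist x y <= gap_dist y x.
Proof.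
case: (gap_distP y x) => [/gap_dist_positivity->|[n yx]]; first by rewrite gap_distxx.
rewrite yx; apply/gap_dist_leP => i iltn; apply/esym; move: i iltn.
by apply/gap_dist_leP; rewrite yx.
Qed.

Lemma gap_dist_sym x y : gap_dist x y = gap_dist y x.
Proof. by apply/eqP; rewrite eq_le !gap_dist_le_sym. Qed.

Lemma gap_dist_ultra x y z (n : nat) : gap_dist x y <= n.+1%:R^-1 ->
  gap_dist y z <= n.+1%:R^-1 -> gap_dist x z <= n.+1%:R^-1.
Proof.
move=> /gap_dist_leP xy /gap_dist_leP yz; apply/gap_dist_leP => i iltn.
by rewrite xy// yz.
Qed.

Lemma gap_dist_triangle y x z : gap_dist x z <= gap_dist x y + gap_dist y z.
Proof.
have [/gap_dist_positivity->|[n xy]] := gap_distP x y.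
  by rewrite gap_distxx add0r.
have [/gap_dist_positivity<-|[m yz]] := gap_distP y z.
  by rewrite gap_distxx addr0.
have [nm|mn] := leqP n m.
  apply: (@le_trans _ _ (gap_dist x y)); last by rewrite lerDl gap_dist_ge0.
  rewrite xy; apply: (@gap_dist_ultra _ y); rewrite ?xy// yz.
  by rewrite lef_pV2 ?posrE// ler_nat.
apply: (@le_trans _ _ (gap_dist y z)); last by rewrite lerDr gap_dist_ge0.
rewrite yz; apply: (@gap_dist_ultra _ y); rewrite ?yz// xy.
by rewrite lef_pV2 ?posrE// ler_nat ltnW.
Qed.

End metric.

HB.instance Definition _ (R : realType) (g : nat -> nat) :=
  isMetric.Build R (gap_shift R g) (@gap_distxx R g) (@gap_dist_positivity R g)
    (@gap_dist_sym R g) (@gap_dist_triangle R g).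


(** * Cylinders, compactness and expansiveness *)

Section dynamics.
Context (R : realType) (g : nat -> nat).
Implicit Types x y z : gap_shift R g.

Lemma mdistE x y : mdist x y = gap_dist x y.
Proof. by []. Qed.

Lemma mdist_leP x y (n : nat) :
  mdist x y <= n.+1%:R^-1 <-> forall i, (i < n)%N -> x i = y i.
Proof. exact: gap_dist_leP. Qed.

Lemma admissible_shift x : admissible g (fun n => x n.+1).
Proof.
move=> i l j l0 nz z jg; rewrite -!addSn; apply: coordP => //.
Qed.

Definition gshift x : gap_shift R g := GapShift R (@admissible_shift x).

Lemma iter_shiftE i x n : iter i gshift x n = x (n + i)%N.
Proof. by elim: i n => [|i IH] n; rewrite ?addn0//= IH addnS addSn. Qed.

Lemma small_radius (e : R) : 0 < e -> exists n : nat, n.+1%:R^-1 < e.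
Proof.
move=> e0; exists (Num.truncn e^-1); rewrite invf_plt ?posrE//.
by rewrite truncnS_gt.
Qed.

Definition cylinder (n : nat) x : set (gap_shift R g) :=
  [set y | forall i, (i < n)%N -> x i = y i].

Lemma cylinder_nbhs n x : nbhs x (cylinder n x).
Proof.
apply: filterS (nbhsx_ballx x (n.+1%:R^-1 : R) _); last by rewrite invr_gt0.
move=> y; rewrite ballEmdist /= => xy; apply/mdist_leP; exact: ltW.
Qed.

Lemma nbhs_cylinder x (U : set (gap_shift R g)) :
  nbhs x U -> exists n, cylinder n x `<=` U.
Proof.
move=> /nbhs_ballP[e /= e0 eU]; have [n ne] := small_radius e0.
exists n => y xy; apply: eU; rewrite ballEmdist /=.
by apply: le_lt_trans ne; apply/mdist_leP.
Qed.

Lemma shift_continuous : continuous gshift.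
Proof.
move=> x U /nbhs_cylinder[n nU]; apply: filterS (cylinder_nbhs n.+1 x) => y xy.
by apply: nU => i iltn; apply: xy.
Qed.

(** An ultrafilter contains exactly one of the three sets that fix the i-th symbol, and these
    symbols form its limit. The limit is admissible because each instance of the condition reads
    finitely many coordinates, on which some point of the shift agrees with it. *)
Lemma gap_shift_compact : compact [set: gap_shift R g].
Proof.
rewrite compact_ultra => F FF _.
have coordF (i : nat) : exists s : 'I_3, F [set x | x i = s].
  apply: contrapT => /forallNP h.
  have : F [set x : gap_shift R g | forall s, x i != s].
    apply: filter_forall => s; have [/h//|] := in_ultra_setVsetC [set x : gap_shift R g | x i = s] FF.
    by apply: filterS => x /eqP.
  by case/filter_ex => x /(_ (x i))/eqP.
pose p i := projT1 (cid (coordF i)).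
have pF (n : nat) : F [set x | forall i, (i < n)%N -> p i = x i].
  suff: F [set x : gap_shift R g | forall i : 'I_n, p i = x i].
    by apply: filterS => x xp i iltn; exact: (xp (Ordinal iltn)).
  apply: filter_forall => i; rewrite /p; case: cid => s /=.
  by apply: filterS.
have adm : admissible g p.
  move=> i l j l0 nz z jg; have /filter_ex[x xp] := pF (i + l + j).+1.
  rewrite xp//; apply: coordP => // [t tl|]; last by rewrite -xp//; lia.
  by rewrite -xp; [exact: nz|lia].
exists (GapShift R adm); split => // U /nbhs_cylinder[n nU].
by apply: filterS (pF n) => x xp; exact: nU.
Qed.

Lemma shift_tds : tds gshift.
Proof.
split; [exact: gap_shift_compact| |exact: shift_continuous].
exists (GapShift R (@admissible_cst g ord0)), (GapShift R (@admissible_cst g ord_max)).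
by move=> /(congr1 (fun x : gap_shift R g => x 0%N)).
Qed.

Lemma shift_positively_expansive : positively_expansive gshift.
Proof.
exists 1 => // x y /gap_shift_diff[n xyn]; exists n.
rewrite leNgt; apply/negP => d1.
(* Below 1 the largest value of the distance is 1/2, which already forces equal symbols at 0. *)
suff: mdist (iter n gshift x) (iter n gshift y) <= 2%:R^-1.
  by move/mdist_leP => /(_ 0%N isT) /eqP; rewrite !iter_shiftE add0n; exact/negP.
move: d1; rewrite mdistE; case: (gap_distP (iter n gshift x) (iter n gshift y)).
  by move=> ->; rewrite invr_ge0.
move=> [[|m] ->]; first by rewrite invr1 ltxx.
by move=> _; rewrite lef_pV2 ?posrE// ler_nat.
Qed.

End dynamics.

(** * The gap lengths *)

Section gap_length.
Context (R : realType).

Lemma sum_expVdiv_le (q n : nat) : (0 < q)%N ->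
  \sum_(k < n) (2 ^- (k %/ q) : R) <= 2 * q%:R.
Proof.
move=> q0.
(* The added term is the exact tail of the series: q - n %% q terms remain in the current block, and
   all the later blocks together weigh as much as q such terms. *)
suff: \sum_(k < n) (2 ^- (k %/ q) : R) + (2 * q%:R - (n %% q)%:R) * 2 ^- (n %/ q)
    = 2 * q%:R.
  move=> <-; rewrite lerDl mulr_ge0// subr_ge0 (@le_trans _ _ q%:R)//.
    by rewrite ler_nat ltnW// ltn_mod.
  by rewrite ler_peMl// ler1n.
elim: n => [|n IH]; first by rewrite big_ord0 mod0n div0n subr0 expr0 invr1; lra.
rewrite big_ord_recr /= -{}[in RHS]IH -addrA; congr (_ + _).
have [nq|nq] := ltnP (n %% q).+1 q.
  have -> : (n.+1 %% q = (n %% q).+1)%N by rewrite -addn1 -modnDml addn1 modn_small.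
  have -> : (n.+1 %/ q = n %/ q)%N.
    by rewrite [in LHS](divn_eq n q) -addnS divnMDl// (divn_small nq) addn0.
  by rewrite -natr1; ring.
have e : ((n %% q).+1 = q)%N by apply/eqP; rewrite eqn_leq nq ltn_mod q0.
have ne : (n.+1 = (n %/ q).+1 * q)%N by rewrite [in LHS](divn_eq n q) -addnS e mulSn addnC.
rewrite ne modnMl mulnK// exprS invfM subr0 -[X in X - (n %% q)%:R]/(2 * q%:R).
have <- : (n %% q)%:R + 1 = q%:R :> R by rewrite natr1 e.
by field; rewrite expf_neq0.
Qed.

(** The blocks of length q sum to at most 2 * q, which the factor 2 ^- c <= 1 / (8 * q) brings down
    to 1/4. *)
Lemma sum_exp_gap_le (q c n : nat) (g : nat -> nat) : (0 < q)%N ->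
  (8 * q <= 2 ^ c)%N -> (forall k, k %/ q + c <= g k)%N ->
  \sum_(k < n) (2 ^- g k : R) <= 4%:R^-1.
Proof.
move=> q0 qc gk; apply: (@le_trans _ _ (\sum_(k < n) (2 ^- (k %/ q) : R) * 2 ^- c)).
  rewrite ler_sum// => k _; rewrite -invfM -exprD lef_pV2 ?posrE ?exprn_gt0//.
  by rewrite ler_eXn2l ?gk// ltr1n.
rewrite -mulr_suml (@le_trans _ _ (2 * q%:R * 2 ^- c))//.
  by rewrite ler_wpM2r ?sum_expVdiv_le// invr_ge0 exprn_ge0.
rewrite ler_pdivrMr ?exprn_gt0// -natrX.
have : (8 * q)%:R <= (2 ^ c)%:R :> R by rewrite ler_nat.
by rewrite natrM; lra.
Qed.

(** For finite tau = t the gap is t * n rounded down plus a constant, which makes the sum small and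
    absorbs the rounding; q > 1/t gives the linear lower bound. The limit allows the shifts m and c
    because [shift_gap] involves such shifts at every precision. *)
Lemma exists_gap_length (tau : \bar R) : (0 < tau)%E ->
  exists (g : nat -> nat) (q : nat),
  [/\ {homo g : m n / (m <= n)%N},
      forall n, (n <= q * g n)%N,
      forall n, \sum_(k < n) (2 ^- g k : R) <= 4%:R^-1 &
      forall m c, ((g (n + m)%N + c)%:R / n%:R)%:E @[n --> \oo] --> tau].
Proof.
case: tau => [t t0|_|//]; last first.
  (* Here q = 1, and 3 is the constant with 8 * q = 2 ^ 3 in [sum_exp_gap_le]. *)
  exists (fun n => n * n + 3)%N, 1%N; split.
  - by move=> m n mn; rewrite leq_add2r leq_mul.
  - by move=> n; nia.
  - by move=> n; apply: (@sum_exp_gap_le 1 3 n (fun k => k * k + 3)%N) => // k; rewrite divn1 leq_add2r; nia.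
  - move=> m c; apply/cvgeyPge => A; near=> n.
    rewrite lee_fin ler_pdivlMr; last by rewrite ltr0n; near: n; exists 1%N.
    rewrite (@le_trans _ _ (n%:R * n%:R))//.
      by rewrite ler_wpM2r//; near: n; apply: nbhs_infty_ger.
    by rewrite -natrM ler_nat; nia.
rewrite lte_fin in t0.
pose q := (Num.truncn t^-1).+1.
have qt : 1 <= q%:R * t by rewrite -ler_pdivrMr// mul1r ltW// truncnS_gt.
have [c c8 qc] : exists2 c, (8 <= c)%N & (8 * q <= 2 ^ c)%N.
  by exists (8 * q)%N; [lia|rewrite ltnW// ltn_expl].
have gq n : (n %/ q <= Num.truncn (t * n%:R))%N.
  rewrite truncn_ge_nat ?mulr_ge0 ?(ltW t0)//.
  have h : (n %/ q)%:R <= (n %/ q)%:R * (q%:R * t).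
    by rewrite -[leLHS]mulr1 ler_wpM2l.
  apply: (le_trans h); rewrite mulrA -natrM mulrC ler_pM2l// ler_nat.
  exact: leq_trunc_div.
exists (fun n => Num.truncn (t * n%:R) + c)%N, q; split.
- by move=> m n mn; rewrite leq_add2r le_truncn// ler_pM2l// ler_nat.
- move=> n; rewrite -(ler_nat R) natrM natrD.
  have := truncnS_gt (t * n%:R); rewrite -natr1 => h.
  rewrite (@le_trans _ _ (q%:R * (t * n%:R)))//.
    by rewrite mulrA ler_peMl.
  rewrite ler_pM2l ?ltr0n// (le_trans (ltW h))// lerD2l ler1n; lia.
- move=> n; apply: (@sum_exp_gap_le q c n (fun k => Num.truncn (t * k%:R) + c)%N) => // k.
  by rewrite leq_add2r.
- move=> m d; apply: (@squeeze_cvge _ _ _ _ (fun=> t%:E) _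
    (fun n => (t + (t * m%:R + (c + d)%:R) / n%:R)%:E)).
  + near=> n.
    have n0 : 0 < n%:R :> R by rewrite ltr0n; near: n; exists 1%N.
    rewrite !lee_fin ler_pdivlMr// ler_pdivrMr// mulrDl mulfVK ?gt_eqF//.
    have /truncn_itv/andP[lo up] : 0 <= t * (n + m)%:R by rewrite mulr_ge0 ?(ltW t0).
    move: lo up; rewrite -natr1 !natrD.
    have : 8 <= c%:R :> R by rewrite ler_nat.
    have : 0 <= d%:R :> R by [].
    have : 0 <= t * m%:R by rewrite mulr_ge0// ltW.
    by lra.
  + exact: cvg_cst.
  + apply: cvg_EFin; first by apply: nearW.
    rewrite -[X in _ --> X]addr0; apply: cvgD; first exact: cvg_cst.
    rewrite -[X in _ --> X](mulr0 (t * m%:R + (c + d)%:R)); apply: cvgM.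
      exact: cvg_cst.
    apply/(@gtr0_cvgV0 _ _ _ _ (fun n : nat => n%:R : R)); last exact: cvgr_idn.
    by exists 1%N => // n /=; rewrite ltr0n.
Unshelve. all: by end_near.
Qed.

End gap_length.

(** * Specification *)

Section specification.
Context (R : realType) (g : nat -> nat) (q : nat).
Hypothesis g_mono : {homo g : m n / (m <= n)%N}.
Hypothesis g_lb : forall n, (n <= q * g n)%N.
Implicit Types x y z : gap_shift R g.

Lemma gap_gt0 n : (0 < n)%N -> (0 < g n)%N.
Proof. by move=> n0; have := g_lb n; case: (g n) => //; rewrite muln0; lia. Qed.

(** [y] keeps its own indexing: a chain of segments is built from the last to the first, and adding
    one on the left must not move those already placed. *)
Definition glue (a L : nat) x y (n : nat) : 'I_3 :=
  if (n < a)%N then ord0 else if (n < a + L)%N then x (n - a)%N else y n.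

(** Since [y] is zero right after the copied word, a run that ends lies in this word or further on
    in [y]. In the word its length is at most L, so the zeros that it needs are found in [x] up to a
    + L and, as [g] is monotone, in [y] beyond. *)
Lemma glue_admissible (a L : nat) x y : (0 < L)%N ->
  (forall n, (n < a + L + g L)%N -> y n = ord0) -> admissible g (glue a L x y).
Proof.
move=> L0 y0 i l j l0 nz z jg.
have gL := gap_gt0 L0.
have ai : (a <= i)%N.
  by rewrite leqNgt; apply/negP => ia; have := nz _ l0; rewrite addn0 /glue ia eqxx.
have glueE n : (a + L <= n)%N -> glue a L x y n = y n.
  by move=> aLn; rewrite /glue !ltnNge aLn (leq_trans _ aLn)//= leq_addr.
have glueE' n : (a <= n)%N -> (n < a + L)%N -> glue a L x y n = x (n - a)%N.
  by move=> an naL; rewrite /glue ltnNge an /= naL.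
have [iaL|iaL] := leqP (a + L) i.
  rewrite glueE ?(leq_trans iaL)// -?addnA ?leq_addr// addnA.
  apply: (@coordP _ _ y i l j l0 _ _ jg) => [t tl|].
    by rewrite -glueE ?nz// (leq_trans iaL)// leq_addr.
  by rewrite -glueE// (leq_trans iaL)// leq_addr.
have ilaL : (i + l <= a + L)%N.
  rewrite leqNgt; apply/negP => h.
  have /nz : (a + L - i < l)%N by lia.
  rewrite subnKC 1?ltnW// glueE// y0 ?eqxx//; lia.
have [iljaL|iljaL] := leqP (a + L) (i + l + j).
  rewrite glueE// y0//.
  have : (g l <= g L)%N by apply: g_mono; lia.
  by lia.
rewrite glueE'//; last lia.
have -> : (i + l + j - a = (i - a) + l + j)%N by lia.
apply: (@coordP _ _ x _ l j l0 _ _ jg) => [t tl|].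
  have -> : (i - a + t = i + t - a)%N by lia.
  rewrite -glueE' ?nz//; lia.
have -> : (i - a + l = i + l - a)%N by lia.
rewrite -glueE'//; lia.
Qed.

(** Each segment is copied with m more symbols, on which the distance at its last times depends. The
    zeros before the first segment are what lets the induction glue one more segment in front. *)
Lemma glue_chain (m k : nat) (x : nat -> gap_shift R g) (a b : nat -> nat) :
  (forall i, (i < k.+1)%N -> (a i <= b i)%N) ->
  (forall i, (i < k)%N ->
    (b i + (m + g ((b i - a i).+1 + m)).+1 <= a i.+1)%N) ->
  exists z : gap_shift R g, (forall n, (n < a 0)%N -> z n = ord0) /\
    forall i n, (i < k.+1)%N -> (a i <= n <= b i + m)%N -> z n = x i (n - a i)%N.
Proof.
have glue_le (a0 b0 : nat) (x0 y z : gap_shift R g) : (a0 <= b0)%N ->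
    z =1 glue a0 ((b0 - a0).+1 + m) x0 y ->
    forall n, (a0 <= n <= b0 + m)%N -> z n = x0 (n - a0)%N.
  move=> ab0 zE n /andP[an nb]; rewrite zE /glue ltnNge an /= ifT//; lia.
elim: k x a b => [|k IH] x a b ab gap.
  have ab0 := ab 0%N isT.
  have adm : admissible g (glue (a 0%N) ((b 0 - a 0).+1 + m)%N (x 0%N)
      (GapShift R (@admissible_cst g ord0))) by apply: glue_admissible; rewrite ?addSn.
  exists (GapShift R adm); split => [n na|[|i] n// _].
    by rewrite /= /glue na.
  exact: glue_le.
have [y [y0 yx]] := IH (x \o S) (a \o S) (b \o S) (fun i => ab i.+1) (fun i => gap i.+1).
have ab0 := ab 0%N isT; have gap0 := gap 0%N isT.
have adm : admissible g (glue (a 0%N) ((b 0 - a 0).+1 + m)%N (x 0%N) y).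
  apply: glue_admissible => [|n na]; first by rewrite addSn.
  by apply: y0; apply: leq_trans gap0; lia.
exists (GapShift R adm); split => [n na|[|i] n ik].
- by rewrite /= /glue na.
- exact: glue_le.
move=> /andP[an nb]; rewrite -(yx i)//=; last by rewrite an.
have bi : (b 0 + (m + g ((b 0 - a 0).+1 + m)).+1 <= n)%N.
  apply: leq_trans an; apply: (leq_trans gap0).
  elim: i ik {nb} => // i IHi ik; apply: (leq_trans (IHi _)); first exact: ltnW.
  by have := ab i.+1; have := gap i.+1 ik; lia.
by rewrite /glue !ifF//; lia.
Qed.

(** With m the truncation of 1/e, the copied word has length n + m, hence the argument of [g]. The m
    extra symbols take m positions, and one more is due because the difference of two times exceeds
    by one the number of positions strictly between them. *)
Definition shift_gap (n : nat) (e : R) : nat :=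
  (g (n + Num.truncn e^-1) + (Num.truncn e^-1).+1)%N.

Lemma shift_gap_function : gap_function (@gshift R g) shift_gap.
Proof.
split.
- by move=> n e _ _; rewrite /shift_gap addnS.
- by move=> m n e _ mn _; rewrite leq_add2r g_mono// leq_add2r.
- move=> n e d _ e0 ed; have de : (Num.truncn d^-1 <= Num.truncn e^-1)%N.
    by rewrite le_truncn// lef_pV2 ?posrE// (lt_le_trans e0 ed).
  by rewrite /shift_gap leq_add ?g_mono ?leq_add2l.
move=> e e0 [//|k] _ x a b ab ba gap.
have [|z [_ zx]] := @glue_chain (Num.truncn e^-1) k x a b ab.
  move=> i ik; have := gap i ik; have := ba i ik; rewrite /shift_gap.
  by set t := Num.truncn _; set u := g _; lia.
exists z => i n ik /andP[an nb].
apply: (@le_trans _ _ (Num.truncn e^-1).+1%:R^-1); last first.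
  by rewrite invf_ple ?posrE// ltW// truncnS_gt.
apply/mdist_leP => t tm; rewrite !iter_shiftE (zx i)//.
  by congr (x i _); lia.
lia.
Qed.

(** Trace n symbols 2, then, after the least gap p that [M] allows, a 0 followed by a 2; precision
    1/2 fixes these symbols. The first zero of the tracing point is at some l with n <= l < n + p,
    and the nonzero symbol at n + p bounds the zeros forced from l on, so g(n) <= g(l) <= n + p - l
    <= p. *)
Lemma gap_function_ge (M : nat -> R -> nat) : gap_function (@gshift R g) M ->
  forall n, (0 < n)%N -> (g n <= M n 2%:R^-1)%N.
Proof.
move=> [M0 _ _ /(_ 2%:R^-1 _) Mspec] n n0.
have h0 : 0 < 2%:R^-1 :> R by rewrite invr_gt0.
pose one := GapShift R (@admissible_cst g ord_max).
pose zero := GapShift R (@admissible_cst g ord0).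
(* The copied word has length 0: this is the point 0 2 2 2 ..., in which no nonzero run ends. *)
have adm : admissible g (glue 1 0 zero one).
  move=> i l j l0 nz z; exfalso; suff : glue 1 0 zero one (i + l) = ord_max by rewrite z.
  by rewrite /glue !ifF//; lia.
pose w := GapShift R adm.
have := Mspec h0 2%N isT (fun i => if i is 0%N then one else w)
  (fun i => if i is 0%N then 0%N else (n.-1 + M n 2%:R^-1)%N)
  (fun i => if i is 0%N then n.-1 else (n.-1 + M n 2%:R^-1).+1).
have := M0 n _ n0 h0; set p := M n _ => p0.
case=> [[|i]//||[|i]//|z zx].
- by move=> [|i]// _; lia.
- by move=> _; rewrite subn0 prednK// -/p; lia.
have z1 t : (t < n)%N -> z t != ord0.
  move=> tn; have /= := zx 0%N t isT; rewrite -ltnS prednK// subn0 => /(_ tn).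
  by move/mdist_leP => /(_ 0%N isT); rewrite -?iterS ?iter_shiftE ?add0n => <-.
have z2 : z (n.-1 + p)%N = ord0.
  have /= := zx 1%N (n.-1 + p)%N isT; rewrite leqnn leqnSn subnn => /(_ isT).
  by move/mdist_leP => /(_ 0%N isT); rewrite -?iterS ?iter_shiftE ?add0n => <-.
have z3 : z (n.-1 + p).+1 != ord0.
  have /= := zx 1%N (n.-1 + p).+1 isT; rewrite leqnn leqnSn subSnn => /(_ isT).
  by move/mdist_leP => /(_ 0%N isT); rewrite -?iterS ?iter_shiftE ?add0n => <-.
have ex : exists i, z i == ord0 by exists (n.-1 + p)%N; apply/eqP.
case: (ex_minnP ex) => l /eqP zl lmin.
have nl : (n <= l)%N by rewrite leqNgt; apply/negP => /z1; rewrite zl eqxx.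
have lp : (l <= n.-1 + p)%N by apply: lmin; rewrite z2.
apply: (leq_trans (g_mono nl)); rewrite leqNgt; apply/negP => pg.
move/eqP: z3; apply.
have -> : ((n.-1 + p).+1 = 0 + l + ((n.-1 + p).+1 - l))%N by lia.
apply: (@coordP _ _ z 0%N l); rewrite ?add0n//; [lia| |lia].
by move=> t tl; apply/negP => /lmin; rewrite leqNgt tl.
Qed.

Lemma shift_nonuniform_specification (tau : \bar R) :
  (forall m c, ((g (n + m)%N + c)%:R / n%:R : R)%:E @[n --> \oo] --> tau) ->
  nonuniform_specification (@gshift R g) tau.
Proof.
move=> g_lim.
have lim_rate (e : R) : limn_einf (fun n => ((shift_gap n e)%:R / n%:R : R)%:E) = tau.
  by have /cvg_limn_einf_sup[-> _] := g_lim (Num.truncn e^-1) (Num.truncn e^-1).+1.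
split.
  exists shift_gap; split; first exact: shift_gap_function.
  apply/eqP; rewrite eq_le; apply/andP; split.
    by apply: ge_ereal_sup => _ [e e0 <-]; rewrite lim_rate.
  by apply: ereal_sup_ubound; exists 1 => /=.
move=> M HM; have M2 := gap_function_ge HM.
apply: (@le_trans _ _ (limn_einf (fun n => ((M n 2%:R^-1)%:R / n%:R : R)%:E))); last first.
  by apply: ereal_sup_ubound; exists 2%:R^-1 => //=; rewrite invr_gt0.
have /cvg_limn_einf_sup[<- _] := g_lim 0%N 0%N.
rewrite !limn_einf_lim; apply: lee_lim; [exact: is_cvg_einfs|exact: is_cvg_einfs|].
apply: nearW => n; apply: le_ereal_inf_tmp => _ [m /= nm <-].
apply: (@le_trans _ _ ((g (m + 0) + 0)%:R / m%:R)%:E).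
  by apply: ereal_inf_lbound; exists m.
rewrite lee_fin; case: m nm => [|m] nm; first by rewrite invr0 !mulr0.
by rewrite ler_wpM2r ?invr_ge0// ler_nat !addn0 M2.
Qed.

End specification.

(** * Topological entropy *)

Section ereal_limits.
Context (R : realType).

(* When the limit does not exist, [lim] takes the junk value [0]. *)
Lemma lim_ereal_le (T : Type) (F : set_system T) (FF : ProperFilter F)
    (u : T -> \bar R) (c : \bar R) : (0 <= c)%E -> (\near F, u F <= c)%E ->
  (lim (u @ F) <= c)%E.
Proof.
move=> c0 uc; have [cu|ncu] := pselect (cvg (u @ F)); first exact: lime_le.
by rewrite (dvgP ncu).
Qed.

Lemma le_limn_esup (u v : nat -> \bar R) :
  (forall n, (u n <= v n)%E) -> (limn_esup u <= limn_esup v)%E.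
Proof.
move=> uv; rewrite !limn_esup_lim.
apply: lee_lim; [exact: is_cvg_esups|exact: is_cvg_esups|].
apply: nearW => n; apply: ge_ereal_sup => _ [m /= nm <-].
by apply: (le_trans (uv m)); apply: ereal_sup_ubound; exists m.
Qed.

Lemma cvg_affine_div (a b : R) : ((a + n%:R * b) / n%:R)%:E @[n --> \oo] --> b%:E.
Proof.
apply: cvg_EFin; first exact: nearW.
have : (fun n : nat => a / n%:R + b) n @[n --> \oo] --> a * 0 + b.
  apply: cvgD; last exact: cvg_cst.
  apply: cvgM; first exact: cvg_cst.
  apply/(@gtr0_cvgV0 _ _ _ _ (fun n : nat => n%:R : R)); last exact: cvgr_idn.
  by exists 1%N => // n /=; rewrite ltr0n.
rewrite mulr0 add0r; apply: cvg_trans; apply: near_eq_cvg.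
exists 1%N => // n /= n0; rewrite mulrDl mulrAC mulfV ?mul1r// pnatr_eq0; lia.
Qed.

End ereal_limits.

(** * Counting words *)

Fixpoint nonzero_words (k : nat) : seq (seq 'I_3) :=
  if k is k.+1 then [seq a :: u | a <- [:: inord 1; ord_max], u <- nonzero_words k]
  else [:: [::]].

Lemma size_nonzero_words k : size (nonzero_words k) = (2 ^ k)%N.
Proof. by elim: k => //= k IH; rewrite cats0 size_cat !size_map IH expnS mul2n addnn. Qed.

Lemma mem_nonzero_words (u : seq 'I_3) : ord0 \notin u -> u \in nonzero_words (size u).
Proof.
elim: u => // a u IH; rewrite inE negb_or => /andP[a0 u0].
apply: (@allpairs_f _ _ _ (fun a u => a :: u) [:: inord 1; ord_max] _ a u); last exact: IH.
rewrite !inE -!val_eqE /= inordK//.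
by case: a a0 => -[|[|[|a]]].
Qed.

Section counting.
Context (R : realType) (g : nat -> nat).
Hypothesis g_sum : forall n, \sum_(k < n) (2 ^- g k : R) <= 4%:R^-1.
Implicit Types x y z : gap_shift R g.

(* Among the words of length [n] starting with exactly [k] nonzero symbols; the zeros
   that these symbols force are cut at length [n]. *)
Definition run_words (W : nat -> seq (seq 'I_3)) (n k : nat) : seq (seq 'I_3) :=
  [seq u ++ nseq (minn (g k) (n - k)) ord0 ++ w |
    u <- nonzero_words k, w <- W (n - k - g k)%N].

Lemma mem_run_words (W : nat -> seq (seq 'I_3)) (n : nat) x :
  (forall m y, (m < n)%N -> mkseq y m \in W m) -> (0 < n)%N -> x 0%N != ord0 ->
  exists k, [/\ (0 < k)%N, (k <= n)%N & mkseq x n \in run_words W n k].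
Proof.
move=> HW n0 x0.
(* The least such k is the length of the initial nonzero run, cut at n. *)
pose P k := (k == n) || (x k == ord0).
have ex : exists k, P k by exists n; rewrite /P eqxx.
case: (ex_minnP ex) => k Pk kmin.
have kn : (k <= n)%N by apply: kmin; rewrite /P eqxx.
have nz t : (t < k)%N -> x t != ord0.
  move=> tk; apply/negP => xt0; have := kmin t; rewrite /P xt0 orbT => /(_ isT); lia.
have k0 : (0 < k)%N.
  by case: k Pk {kmin kn nz}; rewrite // /P (negbTE x0) orbF => /eqP n00; lia.
exists k; split => //.
have zero t : (t < n)%N -> (k <= t < k + g k)%N -> x t = ord0.
  move=> tn /andP[kt tk]; have xk : x k = ord0.
    by move: Pk => /orP[/eqP kn'|/eqP//]; lia.
  rewrite -(subnKC kt) -[k]add0n -addnA add0n.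
  by apply: (@coordP _ _ x 0%N k) => //; rewrite ?add0n//; lia.
have -> : mkseq x n = mkseq x k ++ nseq (minn (g k) (n - k)) ord0 ++
    mkseq (iter (k + g k)%N (@gshift R g) x) (n - k - g k).
  apply: (@eq_from_nth _ ord0); first by rewrite !size_cat !size_mkseq size_nseq; lia.
  move=> i; rewrite size_mkseq => iln; rewrite nth_mkseq// !nth_cat size_mkseq size_nseq.
  case: ifPn => [ik|ki]; first by rewrite nth_mkseq.
  case: ifPn => [im|mi]; first by rewrite nth_nseq im zero//; lia.
  rewrite nth_mkseq; last by lia.
  by rewrite iter_shiftE; congr (x _); lia.
apply: allpairs_f; last by apply: HW; lia.
rewrite -{2}(size_mkseq x k); apply: mem_nonzero_words.
apply/negP => /(nthP ord0)[i]; rewrite size_mkseq => ik; rewrite nth_mkseq// => xi0.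
by have := nz i ik; rewrite xi0 eqxx.
Qed.

(** Splitting by the initial run bounds the number N(n) of words by N(n - 1) plus the sum over k of
    2^k N(n - k - g(k)). If N(m) <= 8 * 2^m below n, the first term is at most 4 * 2^n, the runs
    whose zeros fit give 2 * 2^n by the bound 1/4, and those whose zeros are cut give 2^k each, at
    most 2 * 2^n in all: 4 + 2 + 2 = 8 closes the induction. The cut runs are followed by the empty
    word, for which the bound 8 would be too weak, hence the clause at n = 0. *)
Lemma exists_words (n : nat) : exists W : seq (seq 'I_3),
  [/\ (size W)%:R <= 8%:R * 2 ^+ n :> R, (n = 0%N -> size W <= 1)%N &
    forall x, mkseq x n \in W].
Proof.
elim/ltn_ind: n => n IH.
have [n0|n0] := posnP n.
  by exists [:: [::]]; split; rewrite n0 ?expr0 ?mulr1 ?ler1n.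
have /choice[W HW] : forall j, exists W : seq (seq 'I_3), (j < n)%N ->
    [/\ (size W)%:R <= 8%:R * 2 ^+ j :> R, (j = 0%N -> size W <= 1)%N &
    forall x, mkseq x j \in W].
  move=> j; have [jn|_] := ltnP j n; last by exists [::].
  by have [W] := IH _ jn; exists W.
exists ([seq ord0 :: w | w <- W n.-1] ++ flatten [seq run_words W n k | k <- iota 1 n]).
split; last 2 first.
- by move=> n00; rewrite n00 in n0.
- move=> x; rewrite mem_cat; have [x0|x0] := eqVneq (x 0%N) ord0.
    apply/orP; left; case: n n0 W HW {IH} => // n _ W HW /=.
    have [_ _ Wn] := HW n (ltnSn n).
    rewrite /mkseq /= x0 (iotaDl 1 0 n) -map_comp; apply: map_f.
    exact: (Wn (gshift x)).
  apply/orP; right; apply/flatten_mapP.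
  have [|k [k0 kn xk]] := @mem_run_words W n x _ n0 x0.
    by move=> m y /HW[].
  by exists k => //; rewrite mem_iota; lia.
rewrite size_cat size_map natrD size_flatten /shape -map_comp sumnE big_map.
have -> : iota 1 n = index_iota 1 n.+1 by rewrite /index_iota subn1.
rewrite natr_sum.
have W1 : (size (W n.-1))%:R <= 4%:R * 2 ^+ n :> R.
  have [|h _ _] := HW n.-1; first by lia.
  by rewrite -[n in leRHS]prednK// exprS mulrA -natrM.
have W2 : \sum_(1 <= k < n.+1) (size (run_words W n k))%:R <=
    \sum_(1 <= k < n.+1) (8%:R * 2 ^+ n * 2 ^- g k + 2 ^+ k) :> R.
  rewrite big_nat_cond [leRHS]big_nat_cond; apply: ler_sum => k /andP[/andP[k0 kn] _].
  rewrite size_allpairs size_nonzero_words natrM natrX.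
  have [|h1 h2 _] := HW (n - k - g k)%N; first by lia.
  have [gn|gn] := leqP (g k + k) n.
    rewrite ler_wpDr ?exprn_ge0//.
    apply: (@le_trans _ _ (2 ^+ k * (8%:R * 2 ^+ (n - k - g k)))).
      by rewrite ler_wpM2l// exprn_ge0.
    have {2}-> : (n = k + (n - k - g k) + g k)%N by lia.
    rewrite !exprD le_eqVlt; apply/orP; left; apply/eqP; field.
    by rewrite expf_neq0.
  rewrite ler_wpDl// ?mulr_ge0 ?invr_ge0 ?exprn_ge0//.
  rewrite ler_piMr ?exprn_ge0// lern1 h2//; lia.
have W3 : \sum_(1 <= k < n.+1) (8%:R * 2 ^+ n * 2 ^- g k + 2 ^+ k) <= 4%:R * 2 ^+ n :> R.
  rewrite big_split /= -mulr_sumr.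
  have -> : \sum_(1 <= k < n.+1) 2 ^+ k = 2 ^+ n * 2 - 2 :> R.
    elim: (n) => [|m IHm]; first by rewrite big_geq// expr0; lra.
    by rewrite big_nat_recr//= IHm exprS; lra.
  have : \sum_(1 <= k < n.+1) (2 ^- g k : R) <= 4%:R^-1.
    apply: le_trans (g_sum n.+1); rewrite -(big_mkord predT (fun k => 2 ^- g k)).
    by rewrite [leRHS]big_nat_recl// big_add1 /= lerDr invr_ge0 exprn_ge0.
  have : 0 < 2 ^+ n :> R by rewrite exprn_gt0.
  set p := 2 ^+ n; set s := \sum_(_ <= _ < _) _ => p0 hs.
  by have : p * s <= p * 4%:R^-1 by [rewrite ler_pM2l]; lra.
lra.
Qed.

(** A distance above 1 / (m + 1) shows in the first m symbols, so points separated within n steps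
    have different words of length n + m. *)
Lemma orbit_separated_card (n m : nat) (e : R) (E : {fset gap_shift R g}) :
  m.+1%:R^-1 <= e -> orbit_separated (@gshift R g) n e E ->
  (#|` E|%:R : R) <= 8%:R * 2 ^+ (n + m).
Proof.
move=> me sep; have [W [sW _ HW]] := exists_words (n + m).
apply: le_trans sW; rewrite ler_nat.
have inj : {in enum_fset E &, injective (fun x : gap_shift R g => mkseq x (n + m))}.
  move=> x y xE yE exy; apply: contrapT => xy.
  have [i iln] := sep x y xE yE xy; apply/negP; rewrite -leNgt.
  apply: le_trans me; apply/mdist_leP => j jm; rewrite !iter_shiftE.
  have := congr1 (fun s => nth ord0 s (j + i)) exy; rewrite !nth_mkseq//; lia.
rewrite -(size_map (fun x : gap_shift R g => mkseq x (n + m))).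
apply: uniq_leq_size; first by rewrite map_inj_in_uniq ?fset_uniq.
by move=> _ /mapP[x _ ->].
Qed.

Lemma topological_entropy_le : (topological_entropy (@gshift R g) <= (ln 2)%:E)%E.
Proof.
apply: lim_ereal_le; first by rewrite lee_fin ln_ge0// ler1n.
near=> e; have e0 : 0 < e by near: e; exact: nbhs_right_gt.
have [m /ltW me] := small_radius e0.
pose v (n : nat) : \bar R := (((ln 8 + m%:R * ln 2) + n%:R * ln 2) / n%:R)%:E.
have /cvg_limn_einf_sup[_ <-] : v n @[n --> \oo] --> (ln 2)%:E by exact: cvg_affine_div.
apply: le_limn_esup => n; rewrite /v.
have [->|n0] := posnP n; first by rewrite invr0 mule0 mulr0.
rewrite EFinM; apply: lee_wpmul2r; first by rewrite lee_fin invr_ge0.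
have hms : (max_separated (@gshift R g) n e <= (8%:R * 2 ^+ (n + m))%:E)%E.
  by apply: ge_ereal_sup => _ [E HE <-]; rewrite lee_fin; exact: orbit_separated_card HE.
have pos : 0 < 8%:R * 2 ^+ (n + m) :> R by rewrite mulr_gt0// exprn_gt0.
apply: (@le_trans _ _ (lne (8%:R * 2 ^+ (n + m))%:E)).
  rewrite lee_lne// ?in_itv/= ?leey ?andbT ?lee_fin ?(ltW pos)//.
  (* The empty set is separated, which puts the supremum in [0, +oo], where [lne] is monotone. *)
  apply: ereal_sup_ubound; exists fset0; last by rewrite cardfs0.
  by move=> x y; rewrite inE.
rewrite lne_EFin// lnM ?posrE// ?exprn_gt0// lnXn// lee_fin.
by rewrite mulrnDr -!(mulr_natl (ln 2)); lra.
Unshelve. all: by end_near. Qed.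

End counting.

(** * Borel sets of the subshift *)

Section fibers.
Context (d : measure_display) (T : measurableType d) (R : realType).

Lemma measurable_bigsetU_seq (I : Type) (s : seq I) (A : I -> set T) :
  (forall i, measurable (A i)) -> measurable (\big[setU/set0]_(i <- s) A i).
Proof. by move=> mA; apply: big_ind => //; exact: measurableU. Qed.

Context (J : finType) (F : T -> J).
Hypothesis mF : forall j, measurable [set x | F x = j].

Lemma fibers_bigsetU (P : pred J) :
  [set x | P (F x)] = \big[setU/set0]_(j | P j) [set x | F x = j].
Proof.
rewrite -bigcup_pred; apply/seteqP; split => [x Px|x [j Pj /= ->]//].
by exists (F x).
Qed.

Lemma measurable_fibers (P : pred J) : measurable [set x | P (F x)].
Proof. by rewrite fibers_bigsetU; apply: big_ind => //; exact: measurableU. Qed.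

Lemma measure_fibers (m : {measure set T -> \bar R}) (P : pred J) :
  m [set x | P (F x)] = (\sum_(j | P j) m [set x | F x = j])%E.
Proof.
rewrite -big_filter.
have -> : [set x | P (F x)] = [set x | F x \in [seq j <- index_enum J | P j]].
  by apply/seteqP; split => x /=; rewrite mem_filter mem_index_enum andbT.
have : uniq [seq j <- index_enum J | P j] by rewrite filter_uniq// index_enum_uniq.
elim: [seq _ <- _ | _] => [_|j s IH /= /andP[js us]].
  by rewrite big_nil (_ : [set _ | _] = set0) ?measure0//; apply/seteqP; split=> x.
rewrite big_cons -IH// -measureU//.
- congr (m _); apply/seteqP; split => x /=; rewrite inE.
    by move=> /orP[/eqP|]; [left|right].
  by move=> [->|->]; rewrite ?eqxx ?orbT.
- exact: (measurable_fibers [in s]).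
- by apply/seteqP; split => x //= [->]; exact/negP.
Qed.

Lemma fine_measure_fibers (mu : probability T R) (P : pred J) :
  fine (mu [set x | P (F x)]) = \sum_(j | P j) fine (mu [set x | F x = j]).
Proof.
by rewrite measure_fibers sum_fine// => j _; rewrite fin_num_measure.
Qed.

End fibers.

Section probability_fine.
Context (d : measure_display) (T : measurableType d) (R : realType) (mu : probability T R).
Implicit Types A B : set T.

Lemma fine_measureK A : measurable A -> (fine (mu A))%:E = mu A.
Proof. by move=> mA; rewrite fineK// fin_num_measure. Qed.

Lemma fine_measure_le A B : measurable A -> measurable B -> A `<=` B ->
  fine (mu A) <= fine (mu B).
Proof. by move=> mA mB AB; rewrite -lee_fin !fine_measureK// le_measure ?inE. Qed.

Lemma fine_measureU_le A B : measurable A -> measurable B ->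
  fine (mu (A `|` B)) <= fine (mu A) + fine (mu B).
Proof.
move=> mA mB; rewrite -lee_fin EFinD !fine_measureK ?measureU2//.
exact: measurableU.
Qed.

Lemma fine_measure_bigsetU_le (I : Type) (s : seq I) (A : I -> set T) :
  (forall i, measurable (A i)) ->
  fine (mu (\big[setU/set0]_(i <- s) A i)) <= \sum_(i <- s) fine (mu (A i)).
Proof.
move=> mA; elim: s => [|i s IH]; first by rewrite !big_nil measure0.
rewrite !big_cons (le_trans (fine_measureU_le _ _))//; last by rewrite lerD2l.
exact: measurable_bigsetU_seq.
Qed.

Lemma fine_measure_nondecreasing (F : nat -> set T) (e : R) :
  (forall n, measurable (F n)) -> nondecreasing_seq F -> 0 < e ->
  exists n, fine (mu (\bigcup_n F n `\` F n)) < e.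
Proof.
move=> mF ndF e0; have mU : measurable (\bigcup_n F n) by exact: bigcupT_measurable.
have /fine_cvgP[_ /cvgrPdist_lt/(_ _ e0)[n _ /(_ n (leqnn n)) /= h]] :
    mu (F n) @[n --> \oo] --> (fine (mu (\bigcup_n F n)))%:E.
  by rewrite fine_measureK//; exact: nondecreasing_cvg_mu.
exists n; apply: le_lt_trans h; rewrite measureD ?ltey_eq ?fin_num_measure//.
rewrite fineB ?fin_num_measure//; last exact: measurableI.
by rewrite setIidr ?ler_norm//; exact: bigcup_sup.
Qed.

End probability_fine.

Section borel_sets.
Context (R : realType) (g : nat -> nat).
Local Notation X := (gap_shift R g).
Implicit Types x y : X.

Definition determined (n : nat) (B : set X) : Prop :=
  forall x y, (forall i, (i < n)%N -> x i = y i) -> B x -> B y.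

Lemma determined_le m n (B : set X) : (m <= n)%N -> determined m B -> determined n B.
Proof.
by move=> mn mB x y xy; apply: mB => i im; apply: xy; exact: leq_trans mn.
Qed.

Lemma determinedC n (B : set X) : determined n B -> determined n (~` B).
Proof. by move=> nB x y xy Bx By; apply: Bx; apply: nB By => i /xy ->. Qed.

Lemma determined_open n (B : set X) : determined n B -> open B.
Proof.
move=> nB; rewrite openE => x Bx.
by apply: filterS (cylinder_nbhs n x) => y xy; exact: nB Bx.
Qed.

Lemma open_measurable_borel (U : set X) : open U -> measurable (U : set (borel X)).
Proof. by move=> oU; apply: sub_sigma_algebra. Qed.

Lemma determined_measurable n (B : set X) :
  determined n B -> measurable (B : set (borel X)).
Proof. by move=> /determined_open; exact: open_measurable_borel. Qed.

Definition prefix_word (n : nat) x : {ffun 'I_n -> 'I_3} := [ffun i => x (val i)].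

Lemma prefix_wordP n x y :
  prefix_word n x = prefix_word n y <-> forall i, (i < n)%N -> x i = y i.
Proof.
split=> [/ffunP xy i iltn|];  first by have := xy (Ordinal iltn); rewrite !ffunE.
by move=> xy; apply/ffunP => i; rewrite !ffunE xy//; exact: ltn_ord.
Qed.

Lemma determined_prefix n (P : {ffun 'I_n -> 'I_3} -> Prop) :
  determined n [set x | P (prefix_word n x)].
Proof. by move=> x y /prefix_wordP /= ->. Qed.

Lemma prefix_measurable n (w : {ffun 'I_n -> 'I_3}) :
  measurable ([set x | prefix_word n x = w] : set (borel X)).
Proof. exact: determined_measurable (@determined_prefix n (fun v => v = w)). Qed.

(** The largest subset of [U] determined by [n] symbols. For open [U] these subsets increase to [U],
    so that open sets are reached by monotone limits. *)
Definition inner_cylinders (U : set X) (n : nat) : set X :=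
  [set x | cylinder n x `<=` U].

Lemma inner_cylinders_determined U n : determined n (inner_cylinders U n).
Proof. by move=> x y xy xU z yz; apply: xU => i iltn; rewrite xy// yz. Qed.

Lemma inner_cylinders_nondecreasing U : nondecreasing_seq (inner_cylinders U).
Proof.
move=> m n mn; apply/subsetPset => x mU y xy; apply: mU => i im.
by apply: xy; exact: leq_trans mn.
Qed.

Lemma bigcup_inner_cylinders U : open U -> \bigcup_n inner_cylinders U n = U.
Proof.
rewrite openE => oU; apply/seteqP; split => [x [n _ xU]|x Ux]; first exact: xU.
by have [n nU] := nbhs_cylinder (oU _ Ux); exists n.
Qed.

(** The pi-system is that of the open sets, which generate the Borel sets by definition. Equality
    passes from cylinders to determined sets by additivity, and from these to open sets by
    continuity from below. *)
Lemma measure_eq_cylinders (m1 m2 : {measure set (borel X) -> \bar R}) :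
  (m1 setT < +oo)%E ->
  (forall n (w : {ffun 'I_n -> 'I_3}),
    m1 [set x | prefix_word n x = w] = m2 [set x | prefix_word n x = w]) ->
  forall A, measurable A -> m1 A = m2 A.
Proof.
move=> m1T m12.
have det n (B : set X) : determined n B -> m1 B = m2 B.
  move=> nB; have -> : B = [set x : borel X |
      `[< exists2 y : X, B y & prefix_word n y = prefix_word n x >]].
    apply/seteqP; split => x /= => [Bx|/asboolP[y By /prefix_wordP]].
      by apply/asboolP; exists x.
    by move/nB; apply.
  pose P (w : {ffun 'I_n -> 'I_3}) := `[< exists2 y : X, B y & prefix_word n y = w >].
  rewrite !(@measure_fibers _ _ R _ (prefix_word n : borel X -> _) (@prefix_measurable n) _ P).
  by apply: eq_bigr => w _; exact: m12.
have mT : m1 setT = m2 setT by apply: (det 0%N).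
apply: (@measure_unique _ R (borel X) (@open X) (fun=> setT) _ _ _ _ m1 m2) => //.
- by move=> U V; exact: openI.
- by move=> _; exact: openT.
- by rewrite bigcup_const.
move=> U oU; rewrite -(bigcup_inner_cylinders oU).
have mI n : measurable (inner_cylinders U n : set (borel X)).
  exact: determined_measurable (@inner_cylinders_determined U n).
have mUI : measurable (\bigcup_n inner_cylinders U n : set (borel X)).
  exact: bigcupT_measurable.
have c1 := nondecreasing_cvg_mu (mu := m1) mI mUI (@inner_cylinders_nondecreasing U).
have c2 := nondecreasing_cvg_mu (mu := m2) mI mUI (@inner_cylinders_nondecreasing U).
rewrite -(cvg_lim (@ereal_hausdorff R) c1) -(cvg_lim (@ereal_hausdorff R) c2).
congr (lim (_ @ \oo)); apply/funext => n /=.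
exact: det (@inner_cylinders_determined U n).
Qed.

(** * Approximation of Borel sets by clopen sets *)

Section approximation.
Context (mu : probability (borel X) R).

Definition approximable (A : set (borel X)) : Prop :=
  forall e : R, 0 < e -> exists n (B : set (borel X)),
    [/\ determined n B, fine (mu (A `\` B)) < e & fine (mu (B `\` A)) < e].

Lemma determined_approximable n (B : set (borel X)) : determined n B -> approximable B.
Proof. by move=> nB e e0; exists n, B; rewrite setDv measure0. Qed.

Lemma approximableC A : approximable A -> approximable (~` A).
Proof.
move=> apA e /apA[n [B [nB AB BA]]]; exists n, (~` B).
by rewrite !setDE !setCK setIC -setDE (setIC (~` B)) -setDE; split=> //; exact: determinedC.
Qed.

Lemma fine_measureD_trans (A B C : set (borel X)) :
  measurable A -> measurable B -> measurable C ->
  fine (mu (A `\` C)) <= fine (mu (A `\` B)) + fine (mu (B `\` C)).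
Proof.
move=> mA mB mC; have mAB := measurableD mA mB; have mBC := measurableD mB mC.
apply: le_trans (fine_measureU_le mu mAB mBC); apply: fine_measure_le.
- exact: measurableD.
- exact: measurableU.
- by move=> x [Ax Cx]; have [Bx|Bx] := pselect (B x); [right|left].
Qed.

Lemma approximable_closed A : measurable A ->
  (forall e : R, 0 < e -> exists B, [/\ measurable B, approximable B,
    fine (mu (A `\` B)) < e & fine (mu (B `\` A)) < e]) -> approximable A.
Proof.
move=> mA h e e0; have e2 : 0 < e / 2 by rewrite divr_gt0.
have [B [mB apB AB BA]] := h _ e2; have [n [C [nC BC CB]]] := apB _ e2.
have mC := determined_measurable nC.
exists n, C; split=> //.
  by have := fine_measureD_trans mA mB mC; lra.
by have := fine_measureD_trans mC mB mA; lra.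
Qed.

Lemma approximableU A B : measurable A -> measurable B ->
  approximable A -> approximable B -> approximable (A `|` B).
Proof.
move=> mA mB apA apB e e0; have e2 : 0 < e / 2 by rewrite divr_gt0.
have [n [A' [nA AA A'A]]] := apA _ e2; have [m [B' [mB' BB B'B]]] := apB _ e2.
have mA' := determined_measurable nA; have mB'' := determined_measurable mB'.
exists (maxn n m), (A' `|` B'); split.
- move=> x y xy [A'x|B'x]; [left|right].
    exact: (determined_le (leq_maxl n m) nA) xy A'x.
  exact: (determined_le (leq_maxr n m) mB') xy B'x.
- apply: (@le_lt_trans _ _ (fine (mu (A `\` A')) + fine (mu (B `\` B')))); last lra.
  apply: le_trans (fine_measureU_le mu _ _); try exact: measurableD.
  apply: fine_measure_le; try exact: measurableU; try by apply: measurableU; exact: measurableD.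
    by apply: measurableD; exact: measurableU.
  by move=> x [[Ax|Bx] /not_orP[]]; [left|right].
- apply: (@le_lt_trans _ _ (fine (mu (A' `\` A)) + fine (mu (B' `\` B)))); last lra.
  apply: le_trans (fine_measureU_le mu _ _); try exact: measurableD.
  apply: fine_measure_le; try by apply: measurableU; exact: measurableD.
    by apply: measurableD; exact: measurableU.
  by move=> x [[Ax|Bx] /not_orP[]]; [left|right].
Qed.

Lemma approximable_nondecreasing (F : nat -> set (borel X)) :
  (forall n, measurable (F n)) -> (forall n, approximable (F n)) ->
  nondecreasing_seq F -> approximable (\bigcup_n F n).
Proof.
move=> mF apF ndF; apply: approximable_closed; first exact: bigcupT_measurable.
move=> e e0; have [n hn] := fine_measure_nondecreasing mu mF ndF e0.
exists (F n); split => //; rewrite (_ : _ `\` _ = set0) ?measure0//.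
by apply/seteqP; split => // x [Fx] [] ; exists n.
Qed.

(** The measurable approximable sets contain the open sets and form a sigma-algebra, as they are
    stable under complements, finite unions and increasing limits. *)
Lemma measurable_approximable A : measurable A -> approximable A.
Proof.
move=> mA; suff sa : sigma_algebra setT [set A : set (borel X) | measurable A /\ approximable A].
  suff : [set A : set (borel X) | measurable A /\ approximable A] A by case.
  move: A mA; apply: smallest_sub => // U oU; split; first exact: open_measurable_borel.
  rewrite -(bigcup_inner_cylinders oU); apply: approximable_nondecreasing.
  - by move=> n; exact: determined_measurable (@inner_cylinders_determined U n).
  - by move=> n; exact: determined_approximable (@inner_cylinders_determined U n).
  - exact: inner_cylinders_nondecreasing.
split.
- by split => //; apply: (@determined_approximable 0%N).
- move=> B [mB apB]; rewrite setTD; split; first exact: measurableC.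
  exact: approximableC.
move=> F HF; split; first by apply: bigcupT_measurable => n; case: (HF n).
have mS n : measurable (\big[setU/set0]_(i < n) F i).
  by apply: bigsetU_measurable => i _; case: (HF i).
rewrite -bigcup_bigsetU_bigcup; apply: approximable_nondecreasing => //.
  move=> n; elim: n.+1 => [|k IH].
    by rewrite big_ord0; apply: (@determined_approximable 0%N).
  by rewrite big_ord_recr; apply: approximableU => //; case: (HF k).
move=> m n mn; apply/subsetPset; exact: subset_bigsetU.
Qed.

End approximation.
End borel_sets.

(** * Measure-theoretic entropy *)

Section gibbs.
Context (R : realType).

Lemma ln_le_subr1 (t : R) : 0 < t -> ln t <= t - 1.
Proof.
by move=> t0; have := @le_ln1Dx R (t - 1); rewrite addrCA subrr addr0; apply; lra.
Qed.

Lemma ln_prod (I : finType) (F : I -> R) : (forall i, 0 < F i) ->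
  ln (\prod_i F i) = \sum_i ln (F i).
Proof.
move=> F0; suff [] : 0 < \prod_i F i /\ ln (\prod_i F i) = \sum_i ln (F i) by [].
apply: (big_ind2 (fun p s => 0 < p /\ ln p = s)) => //; first by rewrite ln1.
by move=> p1 s1 p2 s2 [p10 <-] [p20 <-]; rewrite mulr_gt0// lnM.
Qed.

(* With [K b] a sub-probability on [A], [pB b * K b a] is one on [A * B]. *)
Lemma gibbs_conditional (A B : finType) (p : A * B -> R) (K : B -> A -> R) :
  (forall ab, 0 <= p ab) -> (forall b a, 0 < K b a) ->
  (forall b, \sum_a K b a <= 1) ->
  - (\sum_a (\sum_b p (a, b)) * ln (\sum_b p (a, b))) <=
  - (\sum_b (\sum_a p (a, b)) * ln (\sum_a p (a, b))) -
  \sum_a \sum_b p (a, b) * ln (K b a).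
Proof.
move=> p0 K0 K1; pose pA a := \sum_b p (a, b); pose pB b := \sum_a p (a, b).
have pA_le a b : p (a, b) <= pA a.
  by rewrite /pA (bigD1 b)//= lerDl sumr_ge0.
have pB_le a b : p (a, b) <= pB b.
  by rewrite /pB (bigD1 a)//= lerDl sumr_ge0.
have pB0 b : 0 <= pB b by apply: sumr_ge0.
suff : \sum_a \sum_b p (a, b) * (ln (pB b) + ln (K b a) - ln (pA a)) <= 0.
  have -> : \sum_a \sum_b p (a, b) * (ln (pB b) + ln (K b a) - ln (pA a)) =
     \sum_b pB b * ln (pB b) + \sum_a \sum_b p (a, b) * ln (K b a) -
     \sum_a pA a * ln (pA a).
    under [X in X + _ - _]eq_bigr do rewrite [X in X * _]/pB mulr_suml.
    under [X in _ + _ - X]eq_bigr do rewrite [X in X * _]/pA mulr_suml.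
    rewrite [X in X + _ - _]exchange_big -big_split -sumrB /=; apply: eq_bigr => a _.
    rewrite -big_split -sumrB /=; apply: eq_bigr => b _; ring.
  rewrite -/pA -/pB; lra.
(* By ln t <= t - 1 a summand is at most pB * K * (p / pA) - p, and p <= pA. Where p = 0, the
   logarithms may be default values, but they are multiplied by 0. *)
apply: (@le_trans _ _ (\sum_a \sum_b (pB b * K b a - p (a, b)))).
  apply: ler_sum => a _; apply: ler_sum => b _.
  have [p00|pn0] := eqVneq (p (a, b)) 0.
    by rewrite p00 mul0r subr0 mulr_ge0// ltW.
  have pgt0 : 0 < p (a, b) by rewrite lt_def pn0 p0.
  have pA0 : 0 < pA a := lt_le_trans pgt0 (pA_le a b).
  have pB0' : 0 < pB b := lt_le_trans pgt0 (pB_le a b).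
  rewrite -lnM ?posrE// -ln_div ?posrE ?mulr_gt0//.
  apply: (@le_trans _ _ (p (a, b) * (pB b * K b a / pA a - 1))).
    by rewrite ler_pM2l// ln_le_subr1// divr_gt0// mulr_gt0.
  rewrite mulrBr mulr1 lerD2r mulrCA ler_piMr//; last by rewrite ler_pdivrMr// mul1r.
  by rewrite mulr_ge0// ltW.
rewrite exchange_big /=.
apply: (@le_trans _ _ (\sum_b (pB b - pB b))); last by rewrite big1// => b _; rewrite subrr.
apply: ler_sum => b _; rewrite big_split /= sumrN -mulr_sumr lerD2r.
by rewrite ler_piMr.
Qed.

(* The prediction [c] corrected by an error of probability [e]: as a conditional law in
   [gibbs_conditional], it spares the theory of conditional entropy. *)
Definition noisy (k : nat) (e : R) (c a : 'I_k) : R := if a == c then 1 - e else e / k%:R.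

Lemma noisy_gt0 (k : nat) (e : R) (c a : 'I_k) : 0 < e < 1 -> 0 < noisy e c a.
Proof.
move=> /andP[e0 e1]; rewrite /noisy; case: ifP => _; first by rewrite subr_gt0.
by rewrite divr_gt0// ltr0n; case: a => a; lia.
Qed.

Lemma sum_noisy (k : nat) (e : R) (c : 'I_k) : 0 < e -> \sum_a noisy e c a <= 1.
Proof.
move=> e0; rewrite (bigD1 c)//= {1}/noisy eqxx.
have -> : \sum_(a | a != c) noisy e c a = \sum_(a | a != c) e / k%:R.
  by apply: eq_bigr => a ac; rewrite /noisy (negbTE ac).
have k0 : 0 < k%:R :> R by rewrite ltr0n; case: c => c; lia.
have ek : \sum_(a : 'I_k) e / k%:R = e.
  by rewrite sumr_const card_ord -(mulr_natr (e / k%:R)) mulfVK ?gt_eqF.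
by rewrite -[X in 1 - X]ek (bigD1 c)//= opprD addrA subrK gerBl divr_ge0// ltW.
Qed.

Lemma ln_noisy_ge (k : nat) (e : R) (c a : 'I_k) : 0 < e < 1 ->
  - ln (noisy e c a) <= - ln (1 - e) - ln (e / k%:R) *+ (a != c).
Proof.
move=> /andP[e0 e1]; rewrite /noisy; case: eqP => _ /=; first by rewrite mulr0n subr0.
by rewrite mulr1n lerDr oppr_ge0 ln_le0// gerBl ltW.
Qed.

End gibbs.

(** * From arbitrary partitions to words *)

Section generator.
Context (R : realType) (g : nat -> nat).
Local Notation X := (gap_shift R g).
Implicit Types x y : X.

Lemma gshift_preimage_measurable (A : set (borel X)) :
  measurable A -> measurable (@gshift R g @^-1` A : set (borel X)).
Proof.
move: A; suff sa : sigma_algebra setT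
    [set A : set (borel X) | measurable (@gshift R g @^-1` A : set (borel X))].
  apply: smallest_sub => // U oU /=; apply: open_measurable_borel.
  by apply: open_comp => // x _; exact: shift_continuous.
split => /=.
- by rewrite preimage_set0.
- by move=> A mA; rewrite setTD preimage_setC; exact: measurableC.
- by move=> F mF; rewrite preimage_bigcup; exact: bigcupT_measurable.
Qed.

Lemma iter_gshift_preimage_measurable n (A : set (borel X)) :
  measurable A -> measurable (iter n (@gshift R g) @^-1` A : set (borel X)).
Proof.
move=> mA; elim: n => // n IH.
have -> : iter n.+1 (@gshift R g) @^-1` A = @gshift R g @^-1` (iter n (@gshift R g) @^-1` A).
  by apply/funext => x; rewrite /preimage /= -iterSr.
exact: gshift_preimage_measurable.
Qed.

Context (mu : probability (borel X) R).
Hypothesis mu_inv : invariant_measure (@gshift R g) mu.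

Lemma iter_invariant n (A : set (borel X)) :
  measurable A -> mu (iter n (@gshift R g) @^-1` A) = mu A.
Proof.
move=> mA; elim: n => // n <-; rewrite -[RHS]mu_inv.
  by congr (mu _); apply/funext => x; rewrite /preimage /= -iterSr.
exact: iter_gshift_preimage_measurable.
Qed.

Definition prefix_entropy (n : nat) : R :=
  - \sum_(w : {ffun 'I_n -> 'I_3})
      fine (mu [set x | prefix_word n x = w]) *
      ln (fine (mu [set x | prefix_word n x = w])).

Section one_partition.
Context (k : nat) (xi : 'I_k -> set (borel X)).
Hypothesis xi_part : measurable_partition xi.
Variable idx : X -> 'I_k.
Hypothesis idxP : forall x, xi (idx x) x.

Lemma idx_unique x i : xi i x -> idx x = i.
Proof.
case: xi_part => _ [_ tr _] xix; apply: tr => //; exists x; split=> //; exact: idxP.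
Qed.

Definition itinerary (n : nat) x : {ffun 'I_n -> 'I_k} :=
  [ffun i => idx (iter (val i) (@gshift R g) x)].

Lemma join_cellE n (w : {ffun 'I_n -> 'I_k}) :
  join_cell (@gshift R g) xi w = [set x | itinerary n x = w].
Proof.
apply/seteqP; split => [x xw|x /= <- i _ /=]; last by rewrite ffunE; exact: idxP.
by apply/ffunP => i; rewrite ffunE; apply: idx_unique; exact: xw.
Qed.

Lemma idx_fiber_measurable i : measurable ([set x | idx x = i] : set (borel X)).
Proof.
have -> : [set x | idx x = i] = xi i; last by case: xi_part.
apply/seteqP; split => [x <-|x /idx_unique//]; exact: idxP.
Qed.

Lemma itinerary_fiber_measurable n (w : {ffun 'I_n -> 'I_k}) :
  measurable ([set x | itinerary n x = w] : set (borel X)).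
Proof.
rewrite -join_cellE; apply: fin_bigcap_measurable => // i _.
by apply: iter_gshift_preimage_measurable; case: xi_part.
Qed.

Variables (m : nat) (rho : X -> 'I_k).
Hypothesis rho_det : forall x y, (forall i, (i < m)%N -> x i = y i) -> rho x = rho y.

Lemma rho_fiber_measurable i : measurable ([set x | rho x = i] : set (borel X)).
Proof. by apply: (@determined_measurable _ _ m) => x y /rho_det /= ->. Qed.

Lemma mismatch_measurable : measurable ([set x | idx x != rho x] : set (borel X)).
Proof.
apply: (@measurable_fibers _ (borel X) _ (fun x => (idx x, rho x)) _ (fun ij => ij.1 != ij.2)).
move=> [i j]; have -> : [set x | (idx x, rho x) = (i, j)] =
    [set x | idx x = i] `&` [set x | rho x = j].
  by apply/seteqP; split => x /= [-> ->].
exact: measurableI (idx_fiber_measurable i) (rho_fiber_measurable j).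
Qed.

(** The first n + m symbols determine [rho] along n iterates, so Gibbs' inequality applies with the
    word as condition and the product of the [noisy] laws around these predictions. Each coordinate
    costs - ln (1 - e), plus - ln (e / k) where the prediction fails, an event whose probability is
    the same at all times by invariance. *)
Lemma join_entropy_le (n : nat) (e : R) : 0 < e < 1 ->
  join_entropy (@gshift R g) mu xi n <= prefix_entropy (n + m) +
    n%:R * (- ln (1 - e) - ln (e / k%:R) * fine (mu [set x | idx x != rho x])).
Proof.
move=> e01; have /andP[e0 e1] := e01.
pose A := {ffun 'I_n -> 'I_k}; pose B := {ffun 'I_(n + m) -> 'I_3}.
pose F x : A * B := (itinerary n x, prefix_word (n + m) x).
have FE a b : [set x | F x = (a, b)] =
    [set x | itinerary n x = a] `&` [set x | prefix_word (n + m) x = b].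
  by apply/seteqP; split => x; rewrite /F /= => -[-> ->].
have mF ab : measurable ([set x | F x = ab] : set (borel X)).
  case: ab => a b; rewrite FE; apply: measurableI.
    exact: itinerary_fiber_measurable.
  exact: prefix_measurable.
pose p ab := fine (mu [set x | F x = ab]).
have p_sum (P : pred (A * B)) : fine (mu [set x | P (F x)]) = \sum_(ab | P ab) p ab.
  exact: (@fine_measure_fibers _ (borel X) R).
have p1 : \sum_ab p ab = 1.
  rewrite -(p_sum predT) -[1]/(fine 1%E) -(probability_setT mu).
  by congr (fine (mu _)); apply/seteqP.
have pA a : \sum_b p (a, b) = fine (mu [set x | itinerary n x = a]).
  rewrite (_ : [set _ | _] = [set x | (F x).1 == a]); last first.
    by apply/seteqP; split => x /eqP.
  rewrite (p_sum (fun ab => ab.1 == a)); transitivity (\sum_(a' | a' == a) \sum_b p (a', b)).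
    by rewrite big_pred1_eq.
  by rewrite pair_big_dep; apply: eq_big => -[a' b'] //=; rewrite andbT.
have pB b : \sum_a p (a, b) = fine (mu [set x | prefix_word (n + m) x = b]).
  rewrite (_ : [set _ | _] = [set x | (F x).2 == b]); last first.
    by apply/seteqP; split => x /eqP.
  rewrite (p_sum (fun ab => ab.2 == b)); transitivity (\sum_a \sum_(b' | b' == b) p (a, b')).
    by apply: eq_bigr => a _; rewrite big_pred1_eq.
  by rewrite pair_big_dep; apply: eq_big => -[a' b'].
(* For a word that does not occur this is the base point, which is harmless as the word has
   probability 0. *)
pose rep (b : B) : X := xget point [set x | prefix_word (n + m) x = b].
have repE x i : (i < n)%N -> rho (iter i (@gshift R g) (rep (prefix_word (n + m) x))) =
    rho (iter i (@gshift R g) x).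
  move=> iltn; apply: rho_det => j jm; rewrite !iter_shiftE.
  rewrite /rep; case: xgetP => [y _ /prefix_wordP xy|/(_ x)/(_ erefl)//].
  by rewrite xy//; lia.
pose K (b : B) (a : A) : R := \prod_i noisy e (rho (iter (val i) (@gshift R g) (rep b))) (a i).
have K0 b a : 0 < K b a by apply: prodr_gt0 => i _; exact: noisy_gt0.
have K1 b : \sum_a K b a <= 1.
  rewrite /K -(bigA_distr_bigA (fun i j => noisy e (rho (iter (val i) (@gshift R g) (rep b))) j)).
  by apply: prodr_ile1 => i _; rewrite sum_noisy// andbT sumr_ge0// => j _; rewrite ltW// noisy_gt0.
have := @gibbs_conditional R A B p K (fun=> fine_ge0 (measure_ge0 mu _)) K0 K1.
under eq_bigr do rewrite pA; under [X in _ <= - X - _]eq_bigr do rewrite pB.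
rewrite /join_entropy; under [X in _ -> - X <= _]eq_bigr do rewrite join_cellE.
move=> /le_trans; apply; rewrite -/(prefix_entropy _) lerD2l.
rewrite pair_bigA /= -sumrN.
apply: (@le_trans _ _ (\sum_ab \sum_(i < n) p ab *
    (- ln (1 - e) - ln (e / k%:R) *+
      (ab.1 i != rho (iter i (@gshift R g) (rep ab.2)))))).
  apply: ler_sum => -[a b] _ /=; rewrite /K ln_prod => [|i]; last exact: noisy_gt0.
  rewrite -mulrN -sumrN mulr_sumr ler_sum// => i _.
  by rewrite ler_wpM2l ?ln_noisy_ge// fine_ge0.
rewrite exchange_big /= [leRHS]mulr_natl -[n in leRHS]card_ord -sumr_const.
apply: ler_sum => i _.
under eq_bigr do rewrite mulrDr.
rewrite big_split /= -mulr_suml p1 mul1r lerD2l.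
have -> : \sum_(ab : A * B) p ab * - (ln (e / k%:R) *+
      (ab.1 i != rho (iter i (@gshift R g) (rep ab.2)))) = - (ln (e / k%:R) *
    \sum_(ab : A * B | ab.1 i != rho (iter i (@gshift R g) (rep ab.2))) p ab).
  rewrite [in RHS]big_mkcond mulr_sumr -sumrN; apply: eq_bigr => ab _.
  by case: ifP => _; rewrite ?mulr1n ?mulr0n; ring.
rewrite -p_sum -(iter_invariant i mismatch_measurable) le_eqVlt; apply/orP; left.
apply/eqP; congr (- (_ * fine (mu _))); apply/funext => x.
by rewrite /preimage /= ffunE repE// ltn_ord.
Qed.

End one_partition.
End generator.

Section generator_bound.
Context (R : realType) (g : nat -> nat).
Local Notation X := (gap_shift R g).
Context (mu : probability (borel X) R).

(** [rho] picks a cell whose clopen approximation contains the point. If it errs, the approximation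
    of the right cell misses the point or that of a wrong cell contains it, so the point lies in one
    of the k symmetric differences. *)
Lemma exists_determined_index (k : nat) (xi : 'I_k -> set (borel X)) (idx : X -> 'I_k) (d : R) :
  measurable_partition xi -> (forall x, xi (idx x) x) -> 0 < d ->
  exists (m : nat) (rho : X -> 'I_k),
    (forall x y : X, (forall i, (i < m)%N -> x i = y i) -> rho x = rho y) /\
    fine (mu [set x | idx x != rho x]) < d.
Proof.
move=> xi_part idxP d0; have [mxi [_ tr _]] := xi_part.
have k0 : (0 < k)%N by case: (idx point) => i; lia.
(* Each of the k symmetric differences has two halves of measure below e, and 2 * k * e < d. *)
pose e := d / (2 * k%:R + 1).
have e0 : 0 < e by rewrite divr_gt0// ltr_wpDl.
have /choice[nB HB] : forall i, exists nB : nat * set (borel X),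
    [/\ determined nB.1 nB.2, fine (mu (xi i `\` nB.2)) < e &
        fine (mu (nB.2 `\` xi i)) < e].
  by move=> i; have [n [B hB]] := measurable_approximable mu (mxi i) e0; exists (n, B).
pose B i := (nB i).2; pose m := (\max_i (nB i).1)%N.
have B_det i : determined m (B i).
  by have [Bi _ _] := HB i; apply: determined_le Bi; exact: leq_bigmax.
have mB i : measurable (B i) by exact: determined_measurable (B_det i).
pose rho x := odflt (idx point) [pick i | `[< B i x >]].
have rho_det (x y : X) : (forall i, (i < m)%N -> x i = y i) -> rho x = rho y.
  move=> xy; rewrite /rho; congr odflt; apply: eq_pick => i.
  by apply/asboolP/asboolP; apply: B_det => // j /xy.
exists m, rho; split => //.
pose D i := (xi i `\` B i) `|` (B i `\` xi i).
have mD i : measurable (D i) by apply: measurableU; apply: measurableD.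
apply: (@le_lt_trans _ _ (fine (mu (\big[setU/set0]_(i <- enum 'I_k) D i)))).
  apply: fine_measure_le.
  - exact: (mismatch_measurable xi_part idxP rho_det).
  - exact: measurable_bigsetU_seq.
  move=> x /= xrho; apply: contrapT; rewrite -bigcup_seq => nD.
  have nDi i : ~ D i x by move=> Dx; apply: nD; exists i => //=; rewrite mem_enum.
  have Bidx : B (idx x) x by apply: contrapT => nBx; apply: (nDi (idx x)); left.
  move/eqP: xrho; apply; rewrite /rho.
  case: pickP => [i /asboolP Bi /=|/(_ (idx x))/asboolP//].
  apply: (idx_unique xi_part idxP); apply: contrapT => nxi.
  by apply: (nDi i); right.
apply: (le_lt_trans (fine_measure_bigsetU_le mu _ mD)).
apply: (@le_lt_trans _ _ (\sum_(i <- enum 'I_k) (e + e))).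
  apply: ler_sum => i _; have [_ h1 h2] := HB i.
  apply: (le_trans (fine_measureU_le mu _ _)); try exact: measurableD.
  by rewrite lerD// ltW.
rewrite big_const_seq count_predT size_enum_ord iter_addr addr0.
rewrite -mulr2n -mulrnA -(mulr_natr e) /e mulrAC ltr_pdivrMr ?ltr_wpDl//.
by rewrite ltr_pM2l// natrM ltrDl.
Qed.

Lemma partition_entropy_le (c : R) (k : nat) (xi : 'I_k -> set (borel X)) :
  invariant_measure (@gshift R g) mu -> 0 <= c ->
  (forall n, prefix_entropy mu n <= n%:R * c) -> measurable_partition xi ->
  (partition_entropy (@gshift R g) mu xi <= c%:E)%E.
Proof.
move=> mu_inv c0 Hc xi_part; apply/lee_addgt0Pr => d d0.
have /choice[idx idxP] : forall x : X, exists i, xi i x.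
  move=> x; have [_ [cov _ _]] := xi_part.
  have : (\bigcup_(i in [set: 'I_k]) xi i) x by rewrite -coverE cov.
  by case=> i _ xix; exists i.
(* The error d is split in three: - ln (1 - e) = d / 3 by this choice, the mismatch probability is
   taken small against ln (e / k), and the m extra symbols are negligible for large n. *)
pose e := 1 - expR (- (d / 3)).
have e01 : 0 < e < 1.
  by rewrite subr_gt0 gtrBl expR_gt0 expR_lt1 oppr_lt0 divr_gt0.
have d3 : 0 < d / 3 / (`|ln (e / k%:R)| + 1).
  by rewrite !divr_gt0// ltr_wpDl.
have [m [rho [rho_det rho_d]]] := exists_determined_index xi_part idxP d3.
apply: lim_ereal_le; first by rewrite adde_ge0// lee_fin// ltW.
near=> n; have n0 : 0 < n%:R :> R by rewrite ltr0n; near: n; exists 1%N.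
rewrite -EFinD lee_fin ler_pdivrMr//.
apply: (le_trans (join_entropy_le mu_inv xi_part idxP rho_det n e01)).
have -> : - ln (1 - e) = d / 3 by rewrite /e opprB addrC subrK expRK opprK.
have h1 : m%:R * c <= n%:R * (d / 3).
  by rewrite -ler_pdivrMr ?divr_gt0//; near: n; exact: nbhs_infty_ger.
have h2 : - ln (e / k%:R) * fine (mu [set x | idx x != rho x]) <= d / 3.
  have L0 : 0 < `|ln (e / k%:R)| + 1 by rewrite ltr_wpDl.
  apply: (@le_trans _ _ ((`|ln (e / k%:R)| + 1) * fine (mu [set x | idx x != rho x]))).
    by rewrite ler_wpM2r ?fine_ge0// ler_wpDr// -normrN ler_norm.
  by rewrite mulrC -ler_pdivlMr// ltW.
have h3 : n%:R * (- ln (e / k%:R) * fine (mu [set x | idx x != rho x])) <= n%:R * (d / 3).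
  by rewrite ler_pM2l.
have := Hc (n + m)%N; rewrite natrD -mulNr mulrDr; lra.
Unshelve. all: by end_near. Qed.

(* Only the partition by the first symbol has to be tested, since it generates. *)
Lemma measure_entropy_le (c : R) : invariant_measure (@gshift R g) mu -> 0 <= c ->
  (forall n, prefix_entropy mu n <= n%:R * c) ->
  (measure_entropy (@gshift R g) mu <= c%:E)%E.
Proof.
move=> mu_inv c0 Hc; apply: ge_ereal_sup => _ [k [xi [xi_part ->]]].
exact: partition_entropy_le.
Qed.

End generator_bound.

Section symbol_entropy.
Context (R : realType) (g : nat -> nat).
Local Notation X := (gap_shift R g).
Context (mu : probability (borel X) R).

Lemma sum_prefix_law n :
  \sum_(w : {ffun 'I_n -> 'I_3}) fine (mu [set x | prefix_word n x = w]) = 1.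
Proof.
rewrite -(fine_measure_fibers (F := prefix_word n : borel X -> _) (@prefix_measurable R g n) mu predT).
rewrite -[1]/(fine 1%E) -(probability_setT mu).
by congr (fine (mu _)); apply/seteqP.
Qed.

(** Gibbs' inequality with a trivial condition and the uniform law on the 3 ^ n words. *)
Lemma prefix_entropy_le_ln3 n : prefix_entropy mu n <= n%:R * ln 3.
Proof.
pose p (ab : {ffun 'I_n -> 'I_3} * unit) := fine (mu [set x | prefix_word n x = ab.1]).
have sum_unit (F : unit -> R) : \sum_b F b = F tt.
  by rewrite (bigD1 tt)//= big1 ?addr0// => -[].
have K0 (b : unit) (a : {ffun 'I_n -> 'I_3}) : 0 < 3%:R ^- n :> R.
  by rewrite invr_gt0 exprn_gt0.
have K1 (b : unit) : \sum_(a : {ffun 'I_n -> 'I_3}) 3%:R ^- n <= 1 :> R.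
  by rewrite sumr_const card_ffun !card_ord -(mulr_natr (3%:R ^- n)) natrX mulVf//.
have := @gibbs_conditional R _ _ p _ (fun=> fine_ge0 (measure_ge0 mu _)) K0 K1.
under eq_bigr do rewrite sum_unit.
under [X in _ <= _ - X]eq_bigr do rewrite sum_unit.
rewrite sum_unit -mulr_suml sum_prefix_law ln1 mulr0 oppr0 add0r mul1r.
by rewrite lnV ?posrE ?exprn_gt0// lnXn// opprK mulr_natl.
Qed.

Lemma measure_entropy_le_ln3 : invariant_measure (@gshift R g) mu ->
  (measure_entropy (@gshift R g) mu <= (ln 3)%:E)%E.
Proof.
move=> mu_inv; apply: measure_entropy_le => //; last exact: prefix_entropy_le_ln3.
by rewrite ln_ge0// ler1n.
Qed.

Definition symbol_cell (s : 'I_3) : set (borel X) := [set x | x 0%N = s].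

Lemma symbol_partition : measurable_partition symbol_cell.
Proof.
split=> [i|].
  by apply: (@determined_measurable _ _ 1) => x y xy; rewrite /symbol_cell /= xy.
split.
- by apply/seteqP; split => // x _; exists (x 0%N).
- by move=> i j _ _ [x [<- <-]].
- by move=> i _; exists (GapShift R (@admissible_cst g i)).
Qed.

Lemma symbol_join_entropy n :
  join_entropy (@gshift R g) mu symbol_cell n = prefix_entropy mu n.
Proof.
rewrite /join_entropy /prefix_entropy; congr (- _); apply: eq_bigr => w _.
suff -> : join_cell (@gshift R g) symbol_cell w = [set x | prefix_word n x = w] by [].
apply/seteqP; split => x.
  by move=> xw; apply/ffunP => i; rewrite ffunE -(xw i I) iter_shiftE.
by move=> /= <- i _; rewrite /= ffunE /symbol_cell /= iter_shiftE.
Qed.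

Lemma measure_entropy_eq (c : R) : invariant_measure (@gshift R g) mu -> 0 <= c ->
  (forall n, prefix_entropy mu n = n%:R * c) ->
  measure_entropy (@gshift R g) mu = c%:E.
Proof.
move=> mu_inv c0 Hc; apply/eqP; rewrite eq_le; apply/andP; split.
  by apply: measure_entropy_le => // n; rewrite Hc.
apply: ereal_sup_ubound; exists 3%N, symbol_cell; split; first exact: symbol_partition.
rewrite /partition_entropy; apply/esym/cvg_lim; first exact: ereal_hausdorff.
have := @cvg_affine_div R 0 c; under eq_fun do rewrite add0r.
by under [in X in _ -> X]eq_fun do rewrite symbol_join_entropy Hc.
Qed.

Lemma measure_entropy_ge0 : (0 <= measure_entropy (@gshift R g) mu)%E.
Proof.
apply: (@le_trans _ _ (partition_entropy (@gshift R g) mu symbol_cell)); last first.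
  by apply: ereal_sup_ubound; exists 3%N, symbol_cell; split=> //; exact: symbol_partition.
rewrite /partition_entropy; set u := fun n => _.
have [cu|ncu] := pselect (cvgn u); last by rewrite (dvgP ncu).
apply: lime_ge => //; apply: nearW => n; rewrite lee_fin divr_ge0// oppr_ge0.
apply: sumr_le0 => w _; rewrite mulr_ge0_le0 ?fine_ge0// ln_le0//.
suff mJ : measurable (join_cell (@gshift R g) symbol_cell w).
  by rewrite -lee_fin fine_measureK// probability_le1.
apply: fin_bigcap_measurable => // i _; apply: iter_gshift_preimage_measurable.
by case: symbol_partition.
Qed.

End symbol_entropy.

(** * Bernoulli measures *)

Section uniform01.
Context (R : realType).

Let m01 : measurable (`[0, 1[%classic : set (measurableTypeR R)).
Proof. exact: measurable_itv. Qed.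

Definition uniform01 : set (measurableTypeR R) -> \bar R := mrestr lebesgue_measure m01.

HB.instance Definition _ := Measure.on uniform01.

Lemma uniform01_itv (D : set (measurableTypeR R)) (a b : R) : a <= b ->
  D `&` `[0, 1[ = `[a, b[%classic -> uniform01 D = (b - a)%:E.
Proof.
move=> ab DE; rewrite /uniform01 /mrestr DE lebesgue_measure_itv /= lte_fin.
by case: ltP => // ba; rewrite (le_anti (introT andP (conj ab ba))) subrr.
Qed.

Lemma uniform01_setT : uniform01 setT = 1%E.
Proof. by rewrite (@uniform01_itv _ 0 1) ?subr0// setTI. Qed.

HB.instance Definition _ := Measure_isProbability.Build _ _ _ uniform01 uniform01_setT.

End uniform01.

Section coding.
Context (R : realType) (g : nat -> nat) (p : R).
Local Notation X := (gap_shift R g).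

(** The skewed doubling map: [0, p) and [p, 1) are each stretched affinely onto [0, 1), which makes
    the digits independent under Lebesgue measure. *)
Definition expanding_map (u : R) : R := if u < p then u / p else (u - p) / (1 - p).

Definition digit (u : R) : 'I_3 := if u < p then inord 1 else ord_max.

Lemma digit_neq0 u : digit u != ord0.
Proof. by rewrite /digit -val_eqE; case: ifP => _ //=; rewrite inordK. Qed.

Lemma admissible_nonzero (x : nat -> 'I_3) : (forall n, x n != ord0) -> admissible g x.
Proof. by move=> x0 i l j _ _ xil; have := x0 (i + l)%N; rewrite xil eqxx. Qed.

Definition digits (u : measurableTypeR R) : borel X :=
  GapShift R (admissible_nonzero (fun n => digit_neq0 (iter n expanding_map u))).

Lemma digitsE u n : digits u n = digit (iter n expanding_map u).
Proof. by []. Qed.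

Lemma digits_measurable : measurable_fun setT digits.
Proof.
have mexp n : measurable_fun setT (iter n expanding_map : measurableTypeR R -> measurableTypeR R).
  elim: n => [|n IH]; first exact: measurable_id.
  apply: measurableT_comp IH => //; apply: measurable_fun_ifT.
  - apply: (measurable_fun_bool true); rewrite setTI.
    by rewrite (_ : _ @^-1` _ = `]-oo, p[%classic)//; apply/seteqP; split => u /=; rewrite in_itv.
  - exact: mulrr_measurable.
  - apply: (measurableT_comp (f := fun v : R => v / (1 - p))); first exact: mulrr_measurable.
    by apply: measurable_funB => //.
have mlt n : measurable [set u | iter n expanding_map u < p].
  rewrite (_ : [set _ | _] = iter n expanding_map @^-1` `]-oo, p[%classic); last first.
    by apply/seteqP; split => u /=; rewrite in_itv.
  by rewrite -[X in measurable X]setTI; apply: mexp => //; exact: measurable_itv.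
have mdigit n s : measurable [set u | digits u n = s].
  have mb b : measurable [set u : measurableTypeR R | (iter n expanding_map u < p) = b].
    case: b; first exact: (mlt n).
    rewrite (_ : [set _ | _] = ~` [set u | iter n expanding_map u < p]).
      exact: measurableC (mlt n).
    by apply/seteqP; split => u /= => [->|/negP/negbTE].
  rewrite (_ : [set _ | _] =
    [set u | (if iter n expanding_map u < p then inord 1 else ord_max) == s]).
    exact: (measurable_fibers mb (fun b => (if b then inord 1 else ord_max) == s)).
  by apply/seteqP; split => u /eqP.
have mprefix n (w : {ffun 'I_n -> 'I_3}) : measurable [set u | prefix_word n (digits u) = w].
  rewrite (_ : [set _ | _] = \bigcap_(i in [set: 'I_n]) [set u | digits u i = w i]).
    by apply: fin_bigcap_measurable => // i _; exact: mdigit.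
  apply/seteqP; split => [u /= <- i _|u uw] /=; first by rewrite ffunE.
  by apply/ffunP => i; rewrite ffunE; exact: uw.
apply: (@measurability _ _ (measurableTypeR R) (borel X) setT digits (@open X)) => // _ [U oU <-].
rewrite setTI -(bigcup_inner_cylinders oU) preimage_bigcup.
apply: bigcupT_measurable => n.
have -> : digits @^-1` inner_cylinders U n = [set u |
    `[< exists2 y : X, inner_cylinders U n y & prefix_word n y = prefix_word n (digits u) >]].
  apply/seteqP; split => u /= => [Iu|/asboolP[y Iy /prefix_wordP]].
    by apply/asboolP; exists (digits u).
  by move/inner_cylinders_determined; apply.
exact: (measurable_fibers (mprefix n)
  (fun w => `[< exists2 y : X, inner_cylinders U n y & prefix_word n y = w >])).
Qed.

HB.instance Definition _ := isMeasurableFun.Build _ _ _ _ digits digits_measurable.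

Definition bernoulli_shift : set (borel X) -> \bar R := distribution (@uniform01 R) digits.

HB.instance Definition _ := Probability.on bernoulli_shift.
End coding.

Section bernoulli.
Context (R : realType) (g : nat -> nat) (p : R).
Hypothesis p01 : 0 < p < 1.
Local Notation X := (gap_shift R g).
Local Notation mu := (@bernoulli_shift R g p).

Definition weight (s : 'I_3) : R := [:: 0; p; 1 - p]`_s.

Lemma weight_ge0 s : 0 <= weight s.
Proof.
have /andP[p0 p1] := p01; rewrite /weight.
by case: s => -[|[|[|//]]] _ //=; rewrite ?subr_ge0 ltW.
Qed.

Lemma sum_weight : \sum_s weight s = 1.
Proof. by rewrite !big_ord_recl big_ord0 /weight /=; lra. Qed.

(** Induction on the first digit: pulling an interval back by the affine branch of this digit
    multiplies its length by the weight of the digit. The symbol 0 is never a digit and gives an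
    empty interval. *)
Lemma digits_prefix_itv n (w : nat -> 'I_3) : exists a : R,
  [/\ 0 <= a, a + \prod_(i < n) weight (w i) <= 1 &
    forall u : R, (0 <= u < 1 /\ forall i, (i < n)%N -> digits g p u i = w i) <->
      a <= u < a + \prod_(i < n) weight (w i)].
Proof.
have /andP[p0 p1] := p01.
elim: n w => [|n IH] w.
  exists 0; rewrite big_ord0 add0r; split=> // u; split=> [[]|]//.
have [a [a0 a1 aP]] := IH (w \o S).
rewrite big_ord_recl /=; set q := \prod_(i < n) _ in a1 aP *.
have q0 : 0 <= q by apply: prodr_ge0 => i _; exact: weight_ge0.
have digitsS (u : R) : (forall i, (i < n.+1)%N -> digits g p u i = w i) <->
    digit p u = w 0%N /\ forall i, (i < n)%N -> digits g p (expanding_map p u) i = (w \o S) i.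
  split=> [h|[h0 h] [|i] // iln].
    by split => [|i iln]; [exact: (h 0%N)|have := h i.+1 iln; rewrite !digitsE iterSr].
  by have := h i iln; rewrite !digitsE iterSr.
have [w0|[w0|w0]] : w 0%N = ord0 \/ w 0%N = inord 1 \/ w 0%N = ord_max.
  case: (w 0%N) => -[|[|[|//]]] i; [left|right; left|right; right]; apply/val_inj => //=.
  by rewrite inordK.
- exists 0; rewrite w0 /weight mul0r add0r; split => // u; split; last lra.
  move=> [_ /digitsS[+ _]]; rewrite w0 => /eqP; by rewrite (negbTE (digit_neq0 _ _)).
- exists (p * a); rewrite w0 /weight inordK//=; split; [nra|nra|move=> u].
  split.
    move=> [u01 /digitsS[]]; rewrite w0 /digit /expanding_map; case: ltP => [up _ cu|].
      have /aP : 0 <= u / p < 1 /\ forall i, (i < n)%N -> digits g p (u / p) i = (w \o S) i.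
        split => //; apply/andP; split; first by apply: divr_ge0; lra.
        by rewrite ltr_pdivrMr//; lra.
      by rewrite ler_pdivlMr// ltr_pdivrMr//; lra.
    by move=> _ /(congr1 val) /=; rewrite inordK.
  move=> /andP[au ua]; have up : u < p by nra.
  have /aP[up01 cu] : a <= u / p < a + q by rewrite ler_pdivlMr// ltr_pdivrMr//; lra.
  split; first by nra.
  by apply/digitsS; rewrite w0 /digit /expanding_map up.
- exists (p + (1 - p) * a); rewrite w0 /weight /=; split; [nra|nra|move=> u].
  have p1' : 0 < 1 - p by lra.
  split.
    move=> [u01 /digitsS[]]; rewrite w0 /digit /expanding_map; case: ltP => [up|up _ cu].
      by move=> /(congr1 val) /=; rewrite inordK.
    have /aP : 0 <= (u - p) / (1 - p) < 1 /\
        forall i, (i < n)%N -> digits g p ((u - p) / (1 - p)) i = (w \o S) i.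
      split => //; apply/andP; split; first by apply: divr_ge0; lra.
      by rewrite ltr_pdivrMr//; lra.
    by rewrite ler_pdivlMr// ltr_pdivrMr//; lra.
  move=> /andP[au ua]; have up : p <= u by nra.
  have /aP[up01 cu] : a <= (u - p) / (1 - p) < a + q.
    by rewrite ler_pdivlMr// ltr_pdivrMr//; lra.
  split; first by nra.
  by apply/digitsS; rewrite w0 /digit /expanding_map ltNge up.
Qed.

Lemma bernoulli_cylinder n (w : {ffun 'I_n -> 'I_3}) :
  mu [set x | prefix_word n x = w] = (\prod_(i < n) weight (w i))%:E.
Proof.
pose w' i := oapp w ord0 (insub i : option 'I_n).
have w'E (i : 'I_n) : w' i = w i by rewrite /w' valK.
have [a [a0 a1 aP]] := digits_prefix_itv n w'.
have -> : \prod_(i < n) weight (w i) = (a + \prod_(i < n) weight (w' i)) - a.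
  by rewrite addrC addKr; apply: eq_bigr => i _; rewrite w'E.
apply: uniform01_itv.
  by rewrite lerDl; apply: prodr_ge0 => i _; exact: weight_ge0.
apply/seteqP; split => u; rewrite /= !in_itv /=.
  move=> [uw u01]; apply/aP; split=> // i iln.
  by rewrite -[i]/(val (Ordinal iln)) w'E -uw ffunE.
move=> /aP[u01 uw]; split=> //; apply/ffunP => i; rewrite ffunE -w'E.
exact: uw (ltn_ord i).
Qed.

(** A predicate at each coordinate, and not only a symbol, allows coordinates to be left free, as
    invariance requires. *)
Lemma bernoulli_rectangle n (Q : nat -> pred 'I_3) :
  mu [set x : X | forall i, (i < n)%N -> Q i (x i)] =
    (\prod_(i < n) \sum_(s | Q i s) weight s)%:E.
Proof.
have -> : [set x : X | forall i, (i < n)%N -> Q i (x i)] =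
    [set x | [forall i : 'I_n, Q i (prefix_word n x i)]].
  apply/seteqP; split => x /= => [Qx|/forallP Qx i iln].
    by apply/forallP => i; rewrite ffunE; exact: Qx.
  by have := Qx (Ordinal iln); rewrite ffunE.
rewrite (measure_fibers (@prefix_measurable R g n) _
  (fun w : {ffun 'I_n -> 'I_3} => [forall i : 'I_n, Q i (w i)])).
rewrite (eq_bigr (fun w : {ffun 'I_n -> 'I_3} => (\prod_(i < n) weight (w i))%:E)).
  rewrite sumEFin (bigA_distr_big_dep (fun i : 'I_n => Q i)).
  by congr (_%:E); apply: eq_bigl => w; apply/forallP/familyP.
by move=> w _; exact: bernoulli_cylinder.
Qed.

Lemma bernoulli_rectangle_iter m n (Q : nat -> pred 'I_3) :
  mu [set x : X | forall i, (i < n)%N -> Q i (x (i + m)%N)] =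
    (\prod_(i < n) \sum_(s | Q i s) weight s)%:E.
Proof.
have := bernoulli_rectangle (m + n)%N (fun i => if (i < m)%N then xpredT else Q (i - m)%N).
rewrite big_split_ord /= big1 => [|i _]; last by rewrite ltn_ord sum_weight.
rewrite mul1r => H.
rewrite [in RHS](eq_bigr (fun i : 'I_n => \sum_(s | (if (m + i < m)%N then xpredT
   else Q (m + i - m)%N) s) weight s)).
  rewrite -H; congr (mu _); apply/seteqP; split => x /= h i iln.
    case: ltnP => // mi; rewrite -[in x i](subnK mi); apply: h; lia.
  have im : (i + m < m + n)%N by lia.
  by have := h _ im; rewrite addnK ifF//; lia.
by move=> i _; apply: eq_bigl => s; rewrite ltnNge leq_addr /= addKn.
Qed.
Lemma bernoulli_invariant : invariant_measure (@gshift R g) mu.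
Proof.
move=> A mA.
have mf : measurable_fun [set: borel X] (@gshift R g : borel X -> borel X).
  by move=> _ B mB; rewrite setTI; exact: gshift_preimage_measurable.
rewrite -[LHS]/(pushforward mu (@gshift R g : borel X -> borel X) A).
apply: measure_eq_cylinders mA => //.
  by change (mu setT < +oo)%E; rewrite probability_setT ltry.
move=> n w; apply: eq_trans (esym (bernoulli_cylinder w)).
pose Q i : pred 'I_3 := pred1 (oapp w ord0 (insub i : option 'I_n)).
have := bernoulli_rectangle_iter 1 n Q.
rewrite (eq_bigr (fun i : 'I_n => weight (w i))) => [<-|i _]; last first.
  by rewrite /Q valK big_pred1_eq.
congr (mu _); apply/seteqP; split => x /= => [xw i iln|Qx].
  by rewrite /Q insubT /= -xw ffunE addn1.
apply/ffunP => i; have := Qx i (ltn_ord i); rewrite /Q valK ffunE addn1 => /eqP.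
exact.
Qed.

(* By the product formula [mu (C `&` f^-n A) = mu C * mu A] for cylinders [C] of rank [n]
   and all [A]; for invariant [A] this is [mu (C `&` A) = mu C * mu A], which extends
   from cylinders [C] to [C = A]. *)
Lemma bernoulli_ergodic : ergodic_measure (@gshift R g) mu.
Proof.
split; first exact: bernoulli_invariant.
move=> A mA fA.
have iterA n : iter n (@gshift R g) @^-1` A = A.
  elim: n => // n IH; rewrite -[in RHS]fA -[in RHS]IH.
  by apply/funext => x; rewrite /preimage /= -iterSr.
have cylA n (w : {ffun 'I_n -> 'I_3}) (B : set (borel X)) : measurable B ->
    mu ([set x | prefix_word n x = w] `&` iter n (@gshift R g) @^-1` B) =
    ((\prod_(i < n) weight (w i))%:E * mu B)%E.
  move=> mB.
  have mC := @prefix_measurable R g n w.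
  have mf : measurable_fun [set: borel X] (iter n (@gshift R g) : borel X -> borel X).
    by move=> _ D mD; rewrite setTI; exact: iter_gshift_preimage_measurable.
  have c0 : 0 <= \prod_(i < n) weight (w i).
    by apply: prodr_ge0 => i _; exact: weight_ge0.
  (* Both sides are finite measures in [B], a restriction pushed forward and a multiple of [mu], so
     comparing them on cylinders suffices. *)
  rewrite setIC -[LHS]/(pushforward (mrestr mu mC) (iter n (@gshift R g) : borel X -> borel X) B).
  rewrite -[RHS]/(mscale (NngNum c0) mu B).
  apply: measure_eq_cylinders mB => //.
    change (mu (setT `&` [set x | prefix_word n x = w]) < +oo)%E.
    by rewrite setTI bernoulli_cylinder ltry.
  move=> m v.
  change (mu (iter n (@gshift R g) @^-1` [set x | prefix_word m x = v] `&` [set x | prefix_word n x = w]) =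
     (\prod_(i < n) weight (w i))%:E * mu [set x | prefix_word m x = v])%E.
  rewrite bernoulli_cylinder -EFinM.
  pose w' i := oapp w ord0 (insub i : option 'I_n).
  pose v' i := oapp v ord0 (insub i : option 'I_m).
  pose Q i : pred 'I_3 := pred1 (if (i < n)%N then w' i else v' (i - n)%N).
  have := bernoulli_rectangle (n + m) Q.
  rewrite big_split_ord /= (eq_bigr (fun i : 'I_n => weight (w i))); last first.
    by move=> i _; rewrite /Q ltn_ord /w' valK big_pred1_eq.
  rewrite [X in _ * X](eq_bigr (fun i : 'I_m => weight (v i))); last first.
    by move=> i _; rewrite /Q ltnNge leq_addr /= addKn /v' valK big_pred1_eq.
  move=> <-; congr (mu _); apply/seteqP; split => x.
    move=> /= [xv xw] i inm; rewrite /Q; case: ltnP => ni.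
      by rewrite /w' insubT /= -xw ffunE.
    have im : (i - n < m)%N by lia.
    by rewrite /v' insubT /= -xv ffunE iter_shiftE subnK.
  move=> /= Qx; split; apply/ffunP => i; rewrite ffunE.
    have im : (i + n < n + m)%N by rewrite addnC ltn_add2l.
    have /eqP := Qx _ im; rewrite ltnNge leq_addl /= addnK /v' valK /= => <-.
    by rewrite iter_shiftE.
  have im : (i < n + m)%N by rewrite ltn_addr.
  by have /eqP := Qx _ im; rewrite ltn_ord /w' valK.
have indep (B : set (borel X)) : measurable B -> (mu (B `&` A) = mu A * mu B)%E.
  move=> mB; have a0 : 0 <= fine (mu A) by rewrite fine_ge0.
  rewrite -[LHS]/(mrestr mu mA B) -(fine_measureK mu mA) -[RHS]/(mscale (NngNum a0) mu B).
  apply: measure_eq_cylinders mB => //.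
    by change (mu (setT `&` A) < +oo)%E; rewrite setTI ltey_eq fin_num_measure.
  move=> n w; change (mu ([set x | prefix_word n x = w] `&` A) =
    (fine (mu A))%:E * mu [set x | prefix_word n x = w])%E.
  by rewrite -{1}(iterA n) cylA// bernoulli_cylinder muleC fine_measureK.
have a2 : fine (mu A) = fine (mu A) * fine (mu A).
  by apply: EFin_inj; rewrite EFinM !(fine_measureK mu mA) -indep// setIid.
have : fine (mu A) * (fine (mu A) - 1) = 0 by rewrite mulrBr -a2 mulr1 subrr.
move/eqP; rewrite mulf_eq0 subr_eq0 => /orP[/eqP a0|/eqP a1]; [left|right].
  by apply: eq_trans (congr1 EFin a0); rewrite (fine_measureK mu mA).
by apply: eq_trans (congr1 EFin a1); rewrite (fine_measureK mu mA).
Qed.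

Definition binary_entropy (q : R) : R := - (q * ln q + (1 - q) * ln (1 - q)).

Lemma bernoulli_prefix_entropy n : prefix_entropy mu n = n%:R * binary_entropy p.
Proof.
rewrite /prefix_entropy.
rewrite (eq_bigr (fun w : {ffun 'I_n -> 'I_3} =>
  (\prod_i weight (w i)) * ln (\prod_i weight (w i)))) => [|w _]; last first.
  by congr (_ * ln _);
    apply: (@eq_trans _ _ (fine (\prod_i weight (w i))%:E)) => //;
    congr fine; exact: bernoulli_cylinder.
(* As a sum of products in which one factor carries the logarithm, the term can be summed over the
   words coordinate by coordinate. A symbol of weight 0 makes both sides vanish. *)
have lnP (w : {ffun 'I_n -> 'I_3}) :
    (\prod_i weight (w i)) * ln (\prod_i weight (w i)) =
    \sum_(j < n) \prod_i (if i == j then weight (w i) * ln (weight (w i)) else weight (w i)).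
  have [wn0|] := boolP [forall i, weight (w i) != 0]; last first.
    move=> /forallPn[k /negPn/eqP wk].
    rewrite [in LHS](bigD1 k)//= wk !mul0r big1// => j _.
    by rewrite (bigD1 k)//= wk mul0r if_same mul0r.
  rewrite ln_prod => [|i]; last first.
    by rewrite lt_def (forallP wn0) weight_ge0.
  rewrite mulr_sumr; apply: eq_bigr => j _.
  rewrite (bigD1 j)//= [RHS](bigD1 j)//= eqxx mulrAC; congr (_ * _).
  by apply: eq_bigr => i /negbTE ->.
rewrite (eq_bigr _ (fun w _ => lnP w)) exchange_big /=.
rewrite (eq_bigr (fun=> - binary_entropy p)); last first.
  move=> j _.
  rewrite -(bigA_distr_bigA (fun i s => if i == j then weight s * ln (weight s) else weight s)).
  rewrite (bigD1 j)//= eqxx [X in _ * X]big1 ?mulr1 => [|i /negbTE ->]; last first.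
    by rewrite sum_weight.
  by rewrite !big_ord_recl big_ord0 /weight /= /binary_entropy opprK; ring.
by rewrite sumr_const card_ord mulNrn opprK mulr_natl.
Qed.

End bernoulli.

(** * Point masses at fixed points *)

Section dirac.
Context (R : realType) (g : nat -> nat) (a : gap_shift R g).
Hypothesis fixed : gshift a = a.
Local Notation X := (gap_shift R g).
Local Notation delta := (@dirac _ (borel X) a R : probability (borel X) R).

Lemma dirac_invariant : invariant_measure (@gshift R g) delta.
Proof.
by move=> A mA; rewrite /= !diracE; congr ((nat_of_bool _)%:R%:E); apply/idP/idP;
  rewrite !inE /preimage /= fixed.
Qed.

Lemma dirac_ergodic : ergodic_measure (@gshift R g) delta.
Proof.
split; first exact: dirac_invariant.
by move=> A mA _; rewrite /= diracE; case: (a \in A); [right|left].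
Qed.

Lemma dirac_entropy : measure_entropy (@gshift R g) delta = 0%E.
Proof.
apply: measure_entropy_eq => [|//|n]; first exact: dirac_invariant.
rewrite mulr0 /prefix_entropy big1 ?oppr0// => w _.
have [->|->] : fine (delta [set x | prefix_word n x = w]) = 1 \/
    fine (delta [set x | prefix_word n x = w]) = 0.
- have := congr1 fine (@diracE _ (borel X) R a [set x : X | prefix_word n x = w]).
  by case: (a \in _) => /= ->; [left|right].
- by rewrite ln1 mulr0.
- by rewrite mul0r.
Qed.

End dirac.

(** * Realizing the entropies below ln 2 *)

Section intermediate_entropy.
Context (R : realType).

Lemma continuous_binary_entropy (q : R) : 0 < q < 1 -> {for q, continuous (@binary_entropy R)}.
Proof.
move=> /andP[q0 q1]; have q1' : 0 < 1 - q by rewrite subr_gt0.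
apply: cvgN; apply: cvgD; apply: cvgM.
- exact: cvg_id.
- exact: continuous_ln.
- by apply: cvgB; [exact: cvg_cst|exact: cvg_id].
- apply: (@continuous_comp _ _ _ (fun x : R => 1 - x) (@ln R)).
    by apply: cvgB; [exact: cvg_cst|exact: cvg_id].
  exact: continuous_ln.
Qed.

Lemma binary_entropy_half : binary_entropy (2^-1) = ln 2 :> R.
Proof.
rewrite /binary_entropy (_ : 1 - 2^-1 = 2^-1 :> R); last lra.
by rewrite lnV ?posrE//; lra.
Qed.

(** This provides small entropies at positive parameters, so that the intermediate value theorem is
    used away from 0, where [ln] is not continuous. At a square, the crude bound - ln s <= 1/s - 1
    is enough. *)
Lemma binary_entropy_sqr_le (s : R) : 0 < s -> s <= 2^-1 -> binary_entropy (s ^+ 2) <= 3 * s.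
Proof.
move=> s0 s2; have s1 : 0 < 1 - s ^+ 2 by nra.
have h1 : - ln s <= s^-1 - 1 by rewrite -lnV ?posrE// ln_le_subr1// invr_gt0.
have h2 : - ln (1 - s ^+ 2) <= (1 - s ^+ 2)^-1 - 1.
  by rewrite -lnV ?posrE// ln_le_subr1// invr_gt0.
rewrite /binary_entropy lnXn// mulr2n.
have h3 : s ^+ 2 * (- ln s) <= s - s ^+ 2.
  have -> : s - s ^+ 2 = s ^+ 2 * (s^-1 - 1) by field; rewrite gt_eqF.
  by rewrite ler_wpM2l// exprn_ge0// ltW.
have h4 : (1 - s ^+ 2) * (- ln (1 - s ^+ 2)) <= s ^+ 2.
  have e : s ^+ 2 = (1 - s ^+ 2) * ((1 - s ^+ 2)^-1 - 1) by field; rewrite gt_eqF.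
  by rewrite [leRHS]e ler_wpM2l// ltW.
have : 0 <= s ^+ 2 by rewrite exprn_ge0// ltW.
by move: h3 h4; set t := s ^+ 2; set L := ln s; set K := ln _; lra.
Qed.

Lemma binary_entropy_surj (h : R) : 0 < h < ln 2 -> exists2 q, 0 < q < 1 & binary_entropy q = h.
Proof.
move=> /andP[h0 h2].
(* The entropy at s ^+ 2 is at most 3 * s <= h, and s <= 1/2 keeps s ^+ 2 to the left of 1/2. *)
pose s := Num.min (h / 3) 2^-1.
have s0 : 0 < s by rewrite lt_min divr_gt0//= invr_gt0.
have s2 : s <= 2^-1 by rewrite ge_min lexx orbT.
have sh : 3 * s <= h.
  have : s <= h / 3 by rewrite ge_min lexx.
  by rewrite ler_pdivlMr// mulrC.
have s4 : s ^+ 2 <= 2^-1 by nra.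
have [||q] := @IVT R (@binary_entropy R) (s ^+ 2) 2^-1 h s4.
- apply: continuous_in_subspaceT => q; rewrite inE /= in_itv /= => /andP[sq q2].
  apply: continuous_binary_entropy; rewrite (lt_le_trans _ sq) ?exprn_gt0//=; lra.
- rewrite binary_entropy_half ge_min le_max (ltW h2) orbT andbT.
  by rewrite (le_trans (binary_entropy_sqr_le s0 s2) sh).
rewrite in_itv /= => /andP[sq q2] qh; exists q => //.
by rewrite (lt_le_trans _ sq) ?exprn_gt0//=; lra.
Qed.

Variable g : nat -> nat.
Hypothesis g_sum : forall n, \sum_(k < n) (2 ^- g k : R) <= 4%:R^-1.

Lemma gap_intermediate_entropy : intermediate_entropy_property (@gshift R g).
Proof.
move=> h h0 htop; have := lt_le_trans htop (topological_entropy_le g_sum).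
rewrite lte_fin => h2; have [h00|hn0] := eqVneq h 0.
  (* The Bernoulli parameters in (0, 1) only give positive entropies; 0 comes from a fixed point. *)
  pose a := GapShift R (@admissible_cst g ord0).
  have fa : gshift a = a by apply: gap_shift_ext.
  exists (@dirac _ (borel (gap_shift R g)) a R).
  by rewrite h00 dirac_entropy//; split => //; exact: dirac_ergodic.
have [|q q01 <-] := @binary_entropy_surj h; first by rewrite lt_def hn0 h0.
exists (@bernoulli_shift R g q); split; first exact: bernoulli_ergodic.
apply: measure_entropy_eq; [exact: bernoulli_invariant| |exact: bernoulli_prefix_entropy].
have /andP[q0 q1] := q01.
have l1 : ln q <= 0 by rewrite ln_le0// ltW.
have l2 : ln (1 - q) <= 0 by rewrite ln_le0//; lra.
by rewrite /binary_entropy; nra.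
Qed.

End intermediate_entropy.

(** * Pressure *)

Section pressure_gap.
Context (R : realType) (g : nat -> nat) (q : nat).
Hypothesis g_lb : forall n, (n <= q * g n)%N.
Local Notation X := (gap_shift R g).
Implicit Types x y : X.

Definition nonzero_start : set X := [set x | x 0%N != ord0].

Definition run (d : nat) : set X :=
  [set x | (forall i, (i < d)%N -> x i != ord0) /\ x d = ord0].

Definition never_zero : set X := [set x | forall i, x i != ord0].

Lemma nonzero_start_measurable : measurable (nonzero_start : set (borel X)).
Proof. by apply: (@determined_measurable _ _ 1) => x y xy; rewrite /nonzero_start /= xy. Qed.

Lemma run_measurable d : measurable (run d : set (borel X)).
Proof.
apply: (@determined_measurable _ _ d.+1) => x y xy [nz z]; split; last by rewrite -xy.
by move=> i id; rewrite -xy ?nz// ltnS ltnW.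
Qed.

Lemma never_zero_measurable : measurable (never_zero : set (borel X)).
Proof.
have -> : never_zero = \bigcap_n (iter n (@gshift R g) @^-1` nonzero_start).
  apply/seteqP; split => x h n; first by move=> _; rewrite /nonzero_start /= iter_shiftE.
  by have := h n I; rewrite /nonzero_start /= iter_shiftE.
apply: bigcapT_measurable => n.
exact: iter_gshift_preimage_measurable nonzero_start_measurable.
Qed.

Lemma nonzero_startE : nonzero_start = never_zero `|` \bigcup_d run d.+1.
Proof.
apply/seteqP; split => [x x0|x [/(_ 0%N)//|[d _ [+ _]]]]; last exact.
have [nz|/existsNP[i /negP/negPn xi]] := pselect (never_zero x); [by left|right].
have ex : exists i, x i == ord0 by exists i.
case: (ex_minnP ex) => -[|d] /eqP xd min; first by move: x0; rewrite /nonzero_start /= xd eqxx.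
exists d => //; split => // j jd; apply/negP => /min; lia.
Qed.

Context (mu : probability (borel X) R).
Hypothesis mu_inv : invariant_measure (@gshift R g) mu.

(* A run of length [q * j + r + 1] ending at [N - j] is followed by zeros up to [N]
   at least; distinct [j] give disjoint events as [N - j] starts the zeros around [N]. *)
Lemma sum_run_residue_le (r J : nat) : (r < q)%N ->
  \sum_(j < J) fine (mu (run (q * j + r).+1)) <= fine (mu (~` nonzero_start)).
Proof.
(* N leaves room for a run of length d j to end at N - j, for all j < J. *)
move=> rq; pose N := (q * J + J)%N; pose d j := (q * j + r).+1.
have dJ j : (j < J)%N -> (d j + j <= N)%N.
  by move=> jJ; have : (q * j.+1 <= q * J)%N; [rewrite leq_mul2l jJ orbT|rewrite /d /N mulnS; lia].
(* As d j > q * j, the linear bound on [g] yields more than j zeros from N - j on, hence one at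
   N. *)
have gd j : (j < g (d j))%N.
  rewrite ltnNge; apply/negP => gj; have := g_lb (d j).
  have : (q * g (d j) <= q * j)%N by rewrite leq_mul2l gj orbT.
  by rewrite [X in (X <= q * g _)%N]/d; lia.
pose G j : set (borel X) := if (j < J)%N then iter (N - j - d j) (@gshift R g) @^-1` run (d j) else set0.
have mG j : measurable (G j).
  rewrite /G; case: ifP => // _; exact: iter_gshift_preimage_measurable (run_measurable _).
have G_zero j x i : G j x -> (i <= j)%N -> x (N - j + i)%N = ord0.
  rewrite /G; case: ifP => // jJ [nz z] ij; have dN := dJ _ jJ.
  have -> : (N - j + i = (N - j - d j) + d j + i)%N by lia.
  apply: (@coordP _ _ x (N - j - d j)%N (d j) i) => //; last exact: leq_ltn_trans ij (gd j).
    by move=> t td; have := nz t td; rewrite iter_shiftE addnC.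
  by move: z; rewrite iter_shiftE addnC.
have G_nonzero j x : G j x -> (j < J)%N /\ x (N - j).-1 != ord0.
  rewrite /G; case: ifP => // jJ [nz z]; split => //; have dN := dJ _ jJ.
  have := nz (d j).-1; rewrite iter_shiftE /d ltnSn => /(_ isT); congr (x _ != _).
  by rewrite /d in dN *; lia.
have tG : trivIset setT G.
  have disj i j x : (i < j)%N -> G i x -> G j x -> False.
    move=> ij Gi Gj; have [iJ /negP] := G_nonzero i x Gi; apply.
    have [jJ _] := G_nonzero j x Gj; have := dJ j jJ; rewrite /d => h.
    have -> : ((N - i).-1 = N - j + (j - i).-1)%N by lia.
    by apply/eqP; apply: (G_zero j) => //; lia.
  move=> i j _ _ [x [Gi Gj]].
  by have [ij|ji|//] := ltngtP i j; [case: (disj i j x ij Gi Gj)|case: (disj j i x ji Gj Gi)].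
have -> : \sum_(j < J) fine (mu (run (q * j + r).+1)) = fine (mu (\big[setU/set0]_(j < J) G j)).
  have E : mu (\big[setU/set0]_(j < J) G j) = (\sum_(j < J) (fine (mu (G j)))%:E)%E.
    rewrite (measure_bigsetU mu mG tG); apply: eq_bigr => j _.
    by rewrite (fine_measureK mu (mG j)).
  rewrite E sumEFin /=.
  apply: eq_bigr => j _; rewrite /G ltn_ord iter_invariant//; exact: run_measurable.
rewrite -[mu (~` _)](iter_invariant mu_inv N); last first.
  by apply: measurableC; exact: nonzero_start_measurable.
apply: fine_measure_le.
- exact: bigsetU_measurable.
- apply: iter_gshift_preimage_measurable; apply: measurableC; exact: nonzero_start_measurable.
move=> x; rewrite -bigcup_mkord => -[j /= jJ Gj].
rewrite /nonzero_start /= iter_shiftE => /negP; apply.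
have := G_zero j x j Gj (leqnn j); have := dJ j jJ; rewrite subnK => [_ ->//|]; lia.
Qed.

(** The run lengths are split into residue classes modulo q. The disjoint placement works within one
    class at a time, hence the factor q. *)
Lemma sum_run_le J :
  \sum_(d < q * J) fine (mu (run d.+1)) <= q%:R * fine (mu (~` nonzero_start)).
Proof.
have reindex (u : nat -> R) : \sum_(d < q * J) u d = \sum_(r < q) \sum_(j < J) u (q * j + r)%N.
  elim: J => [|J IH].
    by rewrite muln0 big_ord0 big1// => r _; rewrite big_ord0.
  rewrite mulnSr big_split_ord /= IH -big_split /=; apply: eq_bigr => r _.
  by rewrite big_ord_recr.
rewrite (reindex (fun d => fine (mu (run d.+1)))) mulr_natl -[q in leRHS]card_ord -sumr_const.
by apply: ler_sum => r _; apply: sum_run_residue_le.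
Qed.

Lemma q_gt0 : (0 < q)%N.
Proof. by have := g_lb 1; case: q. Qed.

Lemma measure_runs_le :
  fine (mu (\bigcup_d run d.+1)) <= q%:R * fine (mu (~` nonzero_start)).
Proof.
pose F J : set (borel X) := \big[setU/set0]_(d < q * J) run d.+1.
have mF J : measurable (F J) by apply: bigsetU_measurable => d _; exact: run_measurable.
have ndF : nondecreasing_seq F.
  move=> m n mn; apply/subsetPset; apply: (@subset_bigsetU _ (fun d => run d.+1)).
  by rewrite leq_mul2l mn orbT.
have FE : \bigcup_d run d.+1 = \bigcup_J F J.
  apply/seteqP; split => x [d _].
    move=> xd; exists d.+1 => //; rewrite /F -(bigcup_mkord _ (fun d => run d.+1)); exists d => //=.
    by have := q_gt0; nia.
  by rewrite /F -(bigcup_mkord _ (fun d => run d.+1)) => -[i _ xi]; exists i.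
rewrite FE; apply/ler_addgt0Pr => e e0.
have [J hJ] := fine_measure_nondecreasing mu mF ndF e0.
have mU : measurable (\bigcup_J F J) by exact: bigcupT_measurable.
apply: (@le_trans _ _ (fine (mu (F J)) + fine (mu (\bigcup_J F J `\` F J)))).
  apply: le_trans (fine_measureU_le mu (mF J) (measurableD mU (mF J))).
  apply: fine_measure_le => //; first by apply: measurableU => //; exact: measurableD.
  by move=> x Ux; have [Fx|Fx] := pselect (F J x); [left|right].
apply: lerD (ltW hJ); apply: le_trans (sum_run_le J).
by apply: fine_measure_bigsetU_le => d; exact: run_measurable.
Qed.

(** Ergodicity is about sets equal to their preimage, which [never_zero] is not, as a zero may be
    put in front. The increasing union of its preimages is such a set and has the same measure. *)
Lemma never_zero_dichotomy : ergodic_measure (@gshift R g) mu ->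
  fine (mu never_zero) = 0 \/ fine (mu never_zero) = 1.
Proof.
move=> [_ erg].
pose F n : set (borel X) := iter n (@gshift R g) @^-1` never_zero.
have FE n x : F n x <-> forall i, x (i + n)%N != ord0.
  by rewrite /F /never_zero /=; split => h i; have := h i; rewrite iter_shiftE.
have mF n : measurable (F n).
  exact: iter_gshift_preimage_measurable never_zero_measurable.
have ndF : nondecreasing_seq F.
  move=> m n mn; apply/subsetPset => x /FE h; apply/FE => i.
  by rewrite -(subnK mn) addnA.
have mU : measurable (\bigcup_n F n) by exact: bigcupT_measurable.
have muF n : mu (F n) = mu never_zero by rewrite iter_invariant//; exact: never_zero_measurable.
have <- : mu (\bigcup_n F n) = mu never_zero.
  have c := nondecreasing_cvg_mu (mu := mu) mF mU ndF.
  rewrite -(cvg_lim (@ereal_hausdorff R) c); apply: cvg_lim; first exact: ereal_hausdorff.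
  by rewrite (_ : mu \o F = cst (mu never_zero)); [exact: cvg_cst|apply/funext => n /=; exact: muF].
have [||->|->] := erg (\bigcup_n F n) => //; [|by left|by right].
rewrite preimage_bigcup; apply/seteqP; split => x [n _ /FE h].
  by exists n.+1 => //; apply/FE => i; have := h i; rewrite addnS.
exists n => //; apply/FE => i /=; have := h i.+1; by rewrite addSn.
Qed.

Lemma ergodic_nonzero_start : ergodic_measure (@gshift R g) mu ->
  fine (mu nonzero_start) = 1 \/ (q.+1)%:R * fine (mu nonzero_start) <= q%:R.
Proof.
move=> /never_zero_dichotomy hY.
have mN := nonzero_start_measurable; have mY := never_zero_measurable.
have mRuns : measurable (\bigcup_d run d.+1 : set (borel X)).
  by apply: bigcupT_measurable => d; exact: run_measurable.
have N1 : fine (mu nonzero_start) <= 1.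
  by rewrite -lee_fin fine_measureK// probability_le1.
have NC : fine (mu (~` nonzero_start)) = 1 - fine (mu nonzero_start).
  by apply: EFin_inj; rewrite EFinB !fine_measureK ?probability_setC//; exact: measurableC.
case: hY => [Y0|Y1]; [right|left]; last first.
  apply/eqP; rewrite eq_le N1 -Y1 fine_measure_le//.
  by rewrite nonzero_startE => x Yx; left.
have := measure_runs_le; have := fine_measureU_le mu mY mRuns.
rewrite -nonzero_startE Y0 add0r NC -natr1 => h1 h2.
by move: (le_trans h1 h2); lra.
Qed.

End pressure_gap.

(** * A potential with a gap in the ergodic pressures *)

Section potential.
Context (R : realType) (g : nat -> nat) (C : R).
Hypothesis C0 : 0 <= C.
Local Notation X := (gap_shift R g).

Definition nonzero_potential (x : X) : R := C * \1_(@nonzero_start R g) x.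

Lemma nonzero_potential_continuous : continuous nonzero_potential.
Proof.
move=> x U /nbhs_singleton Ux; apply: filterS (cylinder_nbhs 1 x) => y xy.
suff e : nonzero_potential y = nonzero_potential x by rewrite -e in Ux.
rewrite /nonzero_potential !indicE; congr (_ * (nat_of_bool _)%:R).
by apply/idP/idP; rewrite !inE /nonzero_start /= xy.
Qed.

Lemma measure_pressureE (mu : probability (borel X) R) :
  measure_pressure (@gshift R g) nonzero_potential mu =
  (measure_entropy (@gshift R g) mu + (C * fine (mu (@nonzero_start R g)))%:E)%E.
Proof.
have mN := @nonzero_start_measurable R g.
rewrite /measure_pressure; congr (_ + _)%E.
rewrite /nonzero_potential (@integralZl_indic _ (borel X) R mu setT _ (fun=> @nonzero_start R g)) //.
  by rewrite integral_indic// setIT EFinM fine_measureK.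
by move=> C1; have := le_lt_trans C0 C1; rewrite ltxx.
Qed.

Lemma dirac_pressure (s : 'I_3) :
  let a := GapShift R (@admissible_cst g s) in
  invariant_measure (@gshift R g) (@dirac _ (borel X) a R) /\
  measure_pressure (@gshift R g) nonzero_potential (@dirac _ (borel X) a R) =
    (C * (s != ord0)%:R)%:E.
Proof.
move=> a; have fa : gshift a = a by apply: gap_shift_ext.
split; first exact: dirac_invariant.
rewrite measure_pressureE dirac_entropy// add0e; congr ((C * _)%:E).
have -> := congr1 fine (@diracE _ (borel X) R a (@nonzero_start R g)).
by congr ((nat_of_bool _)%:R); apply/idP/idP; rewrite inE.
Qed.

End potential.

(** The constant C = (q + 1) (L + 1) separates the ergodic pressures: they are at least C when
    [nonzero_start] has measure 1, and otherwise at most L + (L + 1) q = C - 1. So C - 1/2 is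
    missed, although it lies between the pressures 0 and C of two fixed points. *)
Lemma not_intermediate_pressure (R : realType) (g : nat -> nat) (q : nat) :
  (forall n, (n <= q * g n)%N) -> ~ intermediate_pressure_property (@gshift R g).
Proof.
move=> g_lb; pose L : R := ln 3.
have L0 : 0 <= L by rewrite ln_ge0// ler1n.
pose C := q.+1%:R * (L + 1).
have q1 : 1 <= q.+1%:R :> R by rewrite ler1n.
have LC : L + 1 <= C by rewrite ler_peMl//; lra.
have C0 : 0 <= C by lra.
move=> /(_ (@nonzero_potential R g C) (@nonzero_potential_continuous R g C) (C - 2^-1)).
case.
- have [inv0 p0] := @dirac_pressure R g C C0 ord0.
  apply: (@le_lt_trans _ _ 0%E); last by rewrite lte_fin; lra.
  by apply: ereal_inf_lbound; eexists; [exact: inv0|rewrite p0 eqxx mulr0].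
- have [inv1 p1] := @dirac_pressure R g C C0 ord_max.
  apply: (@lt_le_trans _ _ C%:E); first by rewrite lte_fin; lra.
  by apply: ereal_sup_ubound; eexists; [exact: inv1|rewrite p1 mulr1].
move=> mu [mu_erg]; have [mu_inv _] := mu_erg.
rewrite measure_pressureE//.
have h0 := measure_entropy_ge0 mu; have hL := measure_entropy_le_ln3 mu_inv.
have [N1|Nq] := ergodic_nonzero_start g_lb mu_inv mu_erg => hP.
  have : (C%:E <= (C - 2^-1)%:E)%E by rewrite -hP N1 mulr1 leeDr.
  by rewrite lee_fin; lra.
have : ((C - 2^-1)%:E <= (L + C * fine (mu (@nonzero_start R g)))%:E)%E.
  by rewrite -hP EFinD leeD2r.
rewrite lee_fin.
have -> : C * fine (mu (@nonzero_start R g)) =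
    (L + 1) * (q.+1%:R * fine (mu (@nonzero_start R g))) by rewrite /C; ring.
have : (L + 1) * (q.+1%:R * fine (mu (@nonzero_start R g))) <= (L + 1) * q%:R.
  by rewrite ler_pM2l//; lra.
have -> : C = (L + 1) * q%:R + L + 1 by rewrite /C -natr1; ring.
lra.
Qed.

Theorem theorem12 (R : realType) (tau : \bar R) (htau : (0 < tau)%E) :
  exists (X : pointedMetricType R) (f : X -> X),
    tds f /\ positively_expansive f /\ nonuniform_specification f tau /\
    intermediate_entropy_property f /\ ~ intermediate_pressure_property f.
Proof.
have [g [q [g_mono g_lb g_sum g_lim]]] := exists_gap_length htau.
exists (gap_shift R g), (@gshift R g); split; first exact: shift_tds.
split; first exact: shift_positively_expansive.
split; first exact: shift_nonuniform_specification g_lim.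
split; first exact: gap_intermediate_entropy.
exact: not_intermediate_pressure g_lb.
Qed.
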